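(* Let $d\ge 2$ be a positive integer, let $p$ be a prime and let $\varepsilon$ be a real number satisfying $0<\varepsilon<1$. Then there exist a group $G$ with $d$ generators and a descending chain $G=G_0\supseteq G_1\supseteq G_2\supseteq\cdots$ of normal subgroups of $G$ of $p$-power index with $\bigcap_{i=1}^{\infty}G_i=\{1\}$ with the following properties: (i) $\liminf_{i\to\infty}\frac{b_1(G_{2i})}{[G:G_{2i}]}\ge d-1-\varepsilon$; (ii) $\lim_{i\to\infty}\frac{b_1(G_{2i-1})}{[G:G_{2i-1}]}=0$. Moreover, if $q$ is a prime different from $p$, then (ii) can be replaced by the stronger condition (ii') $\lim_{i\to\infty}\frac{b_1(G_{2i-1};\mathbb{F}_q)}{[G:G_{2i-1}]}=0$, that is, there exist such $G$ and $(G_i)$ satisfying (i) and (ii').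
   Context: For a finitely generated group $H$ and a field $k$, $b_1(H;k)=\dim_k H_1(H;k)$ (trivial coefficients), and $b_1(H)=b_1(H;\mathbb{Q})$; $\mathbb{F}_q$ is the field with $q$ elements. ''A group with $d$ generators'' means a group that can be generated by $d$ elements. *)

(* Defs.v *)
From HB Require Import structures.
From mathcomp Require Import all_boot all_order all_algebra.
From mathcomp Require Import finmap.
From mathcomp Require Import all_classical all_reals all_analysis.
(* The notations of monalg clash with those of MathComp-Analysis. *)
From mathcomp Require monalg.
Import (canonicals) monalg.

Set Implicit Arguments.
Unset Strict Implicit.
Unset Printing Implicit Defensive.

Import Order.TTheory GRing.Theory Num.Theory.
Import numFieldNormedType.Exports.

Local Open Scope classical_set_scope.
Local Open Scope ring_scope.

Section Subgroups.
Variable G : groupType.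

Record subgroup_type (H : groupClosed G) :=
  SubgroupElt { sgval : G; sgvalP : sgval \in H }.

HB.instance Definition _ (H : groupClosed G) := [isSub for @sgval H].
HB.instance Definition _ (H : groupClosed G) :=
  [Choice of subgroup_type H by <:].

Fact group_closed_pred (H : groupClosed G) : group_closed H.
Proof.
by split=> [|x y xH yH]; [exact: gpred1 | apply: gpredM => //; exact: gpredVr].
Qed.

HB.instance Definition _ (H : groupClosed G) :=
  SubChoice_isSubGroup.Build G _ (subgroup_type H) (group_closed_pred H).

Definition generated_by_elements (d : nat) : Prop :=
  exists s : 'I_d -> G,
    forall H : groupClosed G, (forall i, s i \in H) -> H =i predT.

Definition normal_subgroup (H : groupClosed G) : Prop :=
  forall x y : G, x \in H -> (x ^ y)%g \in H.

Definition lcosets (H : groupClosed G) : set (set G) :=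
  range (fun x : G => [set (x * h)%g | h in [set` H]]).

(* [G : H], with value 0 when the index is infinite. *)
Definition subgroup_index (H : groupClosed G) : nat :=
  #|` fset_set (lcosets H)|.

Definition p_power_index (p : nat) (H : groupClosed G) : Prop :=
  exists n : nat, subgroup_index H = (p ^ n)%N.

Definition p_power_chain (p : nat) (Gs : nat -> groupClosed G) : Prop :=
  [/\ Gs 0%N =i predT,
      forall i, {subset Gs i.+1 <= Gs i},
      forall i, normal_subgroup (Gs i),
      forall i, p_power_index p (Gs i) &
      \bigcap_(i in [set i | (1 <= i)%N]) [set` Gs i] = [set 1%g] ].

End Subgroups.

(* Homology with trivial coefficients, via the (inhomogeneous) bar complex:
   C_n is the free k-module on the n-tuples [g_1|...|g_n], and
   d[g_1|...|g_(n+1)] = [g_2|...|g_(n+1)]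
     + sum_(1 <= i <= n) (-1)^i [g_1|...|g_i g_(i+1)|...|g_(n+1)]
     + (-1)^(n+1) [g_1|...|g_n]. *)
Section Homology.
Variables (H : groupType) (k : fieldType).

Definition bar_chain (n : nat) : lmodType k :=
  monalg.malg {ffun 'I_n -> H} k.

Definition bar_basis (n : nat) (g : {ffun 'I_n -> H}) : bar_chain n :=
  monalg.mkmalgU g 1.

Definition bar_face (n : nat) (i : 'I_n.+2) (g : {ffun 'I_n.+1 -> H}) :
    {ffun 'I_n -> H} :=
  [ffun j : 'I_n =>
    if (j.+1 < i)%N then g (widen_ord (leqnSn n) j)
    else if j.+1 == i :> nat then
      (g (widen_ord (leqnSn n) j) * g (lift ord0 j))%g
    else g (lift ord0 j)].

Definition bar_diff (n : nat) (x : bar_chain n.+1) : bar_chain n :=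
  \sum_(g <- monalg.msupp x) monalg.mcoeff g x *:
    (\sum_(i < n.+2) (-1) ^+ i *: bar_basis (bar_face i g)).

(* The classes of the cycles e_0, ..., e_(n-1) form a basis of
   H_1(H; k) = ker (d : C_1 -> C_0) / im (d : C_2 -> C_1). *)
Definition H1_basis (n : nat) (e : 'I_n -> bar_chain 1) : Prop :=
  (forall i, bar_diff (e i) = 0) /\
  forall z : bar_chain 1, bar_diff z = 0 ->
    exists! c : 'rV[k]_n,
      exists y : bar_chain 2, z - \sum_(i < n) c 0 i *: e i = bar_diff y.

(* dim_k H_1(H; k), with value +oo when H_1(H; k) is infinite dimensional
   (which does not happen for a finitely generated H). *)
Definition b1 (R : realType) : \bar R :=
  xget +oo%E
    [set n%:R%:E | n in [set n | exists e : 'I_n -> bar_chain 1, H1_basis e]].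

End Homology.

Definition b1_ratio (R : realType) (k : fieldType) (G : groupType)
    (H : groupClosed G) : \bar R :=
  (b1 (subgroup_type H) k R * ((subgroup_index H)%:R^-1)%:E)%E.

(* Main.v *)
Require Import Defs.
From HB Require Import structures.
From mathcomp Require Import all_boot all_order all_algebra all_fingroup all_solvable.
From mathcomp Require Import finmap.
From mathcomp Require Import all_classical all_reals all_analysis.
From mathcomp Require monalg.
Import (canonicals) monalg.
From mathcomp Require Import lra.

Set Implicit Arguments.
Unset Strict Implicit.
Unset Printing Implicit Defensive.

Import Order.TTheory GRing.Theory Num.Theory.
Import numFieldNormedType.Exports.

Local Open Scope classical_set_scope.
Local Open Scope ring_scope.

(** Let [F] be free on [d] letters. The group is [G = F / N], where [N] is the
    intersection of a descending chain [F = K_0 >= L_0 >= K_1 >= L_1 >= ...] of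
    normal subgroups of [p]-power index, and [G_(2i) = K_i / N],
    [G_(2i+1) = L_i / N]. The chain is built along with a growing finite list of
    relators of the form [x ^ q], [q] a power of [p]; the normal closure [M_i] of
    the relators known at stage [i] lies in every [K_j], hence in [N].

    _Even terms._ Let [K = K_i], let [n = [F : K]], and suppose that in every
    relator [x ^ q] of stage [i] the element [x] has order exactly [q] modulo
    [K]. A rational cochain on the Cayley graph of [F / K], which has [n]
    vertices and [d n] edges, integrates along words to a homomorphism from [K]
    to the rationals, which vanishes only for coboundaries ([coboundary]). The
    relator [x ^ q] winds once around an [x]-orbit in [F / K], and there are
    [n / q] orbits, so killing all conjugates of [x ^ q] costs at most [n / q]
    linear conditions. Hence the homomorphisms on [K] that kill [M_i] form a space of
    dimension at least [n (d - 1 - sum 1/q)] ([hom_count]), and the construction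
    keeps [sum 1/q < eps]. Passing from [M_i] to the larger [N] loses nothing:
    later relators are powers of elements of [[K, K]], and each later stage
    pushes the values of such a homomorphism into [p] times its previous values,
    so that, its denominators being bounded, it dies on [N] ([tower_hom_cap]).

    _Odd terms._ Let [y_1, ..., y_r] generate [K] and put
    [L = M K^(p^j) [K, K]]. By Schreier's lemma [L] is generated by [M], by the
    [r] elements [y ^ (p^j)] and by finitely many [c] in [[K, K]]. If every [c]
    has [p]-power order in [G], then over a field in which [p] is invertible the
    first homology of [L / N] is spanned by [r] classes. The number [r] depends
    on [K] only, whereas [[F : L]] tends to infinity with [j] because [K / M]
    has a nonzero homomorphism to the integers; so the ratio is as small as
    desired.

    _Making [c] torsion cheaply._ Either some fixed [c ^ (p^m)] lies in every
    normal subgroup of [p]-power index that contains [M], hence in [N]; or one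
    of these subgroups gives [c] an arbitrarily large order [q], and the new
    relator [c ^ q] adds only [1/q] to the sum ([avoid_powers], [stage_step]).

    The bar complex enters through two facts: the class of [[h]] in the first
    homology is additive in [h], which bounds the dimension from above by the
    number of classes needed to span ([b1_upper]); and a homomorphism to the
    field that vanishes on a basis of the first homology is zero
    ([hom_basis_vanish]), which bounds it from below. *)

(** * Subgroups as predicates, transversals and index *)

Section SubgroupTheory.
Local Open Scope group_scope.
Variable G : groupType.
Implicit Types (H K M S : set G) (x y z : G).

Record is_subgroup H : Prop := IsSubgroup {
  subgroup1 : H 1;
  subgroupM : forall x y, H x -> H y -> H (x * y);
  subgroupV : forall x, H x -> H x^-1 }.

Record is_normal H : Prop := IsNormal {
  normal_is_subgroup :> is_subgroup H;
  normal_conj : forall x y, H x -> H (x ^ y) }.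

Inductive gen S : set G :=
| gen_one : gen S 1
| gen_in x : S x -> gen S x
| gen_mul x y : gen S x -> gen S y -> gen S (x * y)
| gen_inv x : gen S x -> gen S x^-1.

Lemma gen_subgroup S : is_subgroup (gen S).
Proof. by split; [exact: gen_one|exact: gen_mul|exact: gen_inv]. Qed.

Lemma gen_min S H : is_subgroup H -> S `<=` H -> gen S `<=` H.
Proof.
move=> [H1 HM HV] sSH x; elim=> //.
- by move=> y z _ Hy _ Hz; exact: HM.
- by move=> y _; exact: HV.
Qed.

Lemma gen_sub S S' : S `<=` S' -> gen S `<=` gen S'.
Proof. by move=> sS; apply: gen_min (gen_subgroup _) _ => x /sS; exact: gen_in. Qed.

Lemma gen_normal S :
  (forall x y, S x -> S (x ^ y)) -> is_normal (gen S).
Proof.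
move=> SJ; split; first exact: gen_subgroup.
move=> x y; elim=> [|z /(SJ _ y)|z t _ Hz _ Ht|z _ Hz].
- by rewrite conj1g; exact: gen_one.
- exact: gen_in.
- by rewrite conjMg; exact: gen_mul.
- by rewrite conjVg; exact: gen_inv.
Qed.

Lemma subgroupX H x n : is_subgroup H -> H x -> H (x ^+ n).
Proof.
move=> HH Hx; elim: n => [|n IH]; first by rewrite expg0; exact: subgroup1.
by rewrite expgS; exact: subgroupM.
Qed.

Lemma subgroupMl H x y : is_subgroup H -> H x -> H (x * y) -> H y.
Proof.
by move=> HH Hx Hxy; rewrite -(mulKg x y); apply: subgroupM => //; exact: subgroupV.
Qed.

Lemma subgroupMr H x y : is_subgroup H -> H y -> H (x * y) -> H x.
Proof.
by move=> HH Hx Hxy; rewrite -(mulgK y x); apply: subgroupM => //; exact: subgroupV.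
Qed.

Lemma subgroupVE H x : is_subgroup H -> H x^-1 -> H x.
Proof. by move=> HH /(subgroupV HH); rewrite invgK. Qed.

Lemma normal_mulC H x y : is_normal H -> H (x * y) -> H (y * x).
Proof. by move=> HH /(normal_conj HH x); rewrite conjgE -!mulgA mulKg. Qed.

Lemma is_subgroupI H K : is_subgroup H -> is_subgroup K -> is_subgroup (H `&` K).
Proof.
move=> [H1 HM HV] [K1 KM KV]; split=> [//|x y [Hx Kx] [Hy Ky]|x [Hx Kx]].
  by split; [exact: HM|exact: KM].
by split; [exact: HV|exact: KV].
Qed.

Lemma is_normalI H K : is_normal H -> is_normal K -> is_normal (H `&` K).
Proof.
move=> HH HK; split=> [|x y [Hx Kx]]; first exact: (is_subgroupI HH HK).
by split; [exact: (normal_conj HH)|exact: (normal_conj HK)].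
Qed.

Definition commutators K : set G :=
  gen [set z | exists x y, [/\ K x, K y & z = [~ x, y]]].

Lemma commutators_normal K : is_normal K -> is_normal (commutators K).
Proof.
move=> HK; apply: gen_normal => z t [x [y [Kx Ky ->]]].
by exists (x ^ t), (y ^ t); rewrite conjRg; split=> //; exact: normal_conj.
Qed.

Lemma commutators_sub K : is_subgroup K -> commutators K `<=` K.
Proof.
move=> HK; apply: gen_min => // z [x [y [Kx Ky ->]]].
rewrite /commg /conjg; apply: (subgroupM HK); first exact: subgroupV.
apply: (subgroupM HK); first exact: subgroupV.
exact: subgroupM.
Qed.

(** A map to a finite type each of whose fibres lies in one coset: in this
    form finite index passes to intersections by pairing the maps. *)
Definition separated_by (T : finType) (f : G -> T) H :=
  forall x y, f x = f y -> H (x^-1 * y).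

Definition finite_index H := exists (T : finType) (f : G -> T), separated_by f H.

(** For a normal subgroup of finite index, a [p]-power exponent of the
    quotient is the same as a [p]-power index (Cauchy), and it is much easier
    to propagate. *)
Record p_normal (p : nat) H : Prop := PNormal {
  p_normal_normal :> is_normal H;
  p_normal_finite : finite_index H;
  p_normal_exponent : exists n, forall x, H (x ^+ (p ^ n)%N) }.

Lemma p_normalI p H K : p_normal p H -> p_normal p K -> p_normal p (H `&` K).
Proof.
move=> [nH [T [f fP]] [n nP]] [nK [T' [f' f'P]] [n' n'P]]; split.
- exact: is_normalI.
- exists (T * T')%type, (fun x => (f x, f' x)) => x y [/fP ? /f'P ?]; by split.
- exists (n + n')%N => x; split.
    by rewrite expnD expgnA; apply: subgroupX => //; exact: nH.
  by rewrite addnC expnD expgnA; apply: subgroupX => //; exact: nK.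
Qed.

(** The classifying map [c] comes with the representatives [t], so that a
    coset is an element of ['I_n] and the index is [n] by construction. *)
Record is_transversal H n (t : 'I_n -> G) (c : G -> 'I_n) : Prop := IsTransversal {
  transversal_rep : forall x, H ((t (c x))^-1 * x);
  transversal_eq : forall x y, H (x^-1 * y) -> c x = c y;
  transversalK : forall i, c (t i) = i }.

Lemma transversalP H n t c : is_subgroup H -> @is_transversal H n t c ->
  forall x y, c x = c y <-> H (x^-1 * y).
Proof.
move=> HH tc x y; split=> [E|]; last exact: (transversal_eq tc).
have Hx := transversal_rep tc x; have Hy := transversal_rep tc y.
rewrite -E in Hy; set s := t _ in Hx Hy.
have -> : x^-1 * y = (s^-1 * x)^-1 * (s^-1 * y) by rewrite invgM invgK -mulgA mulVKg.
by apply: (subgroupM HH) => //; exact: subgroupV.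
Qed.

(** Replacing each element by a canonical representative of its coset makes a
    separating map constant on cosets; its image then indexes them. *)
Lemma finite_index_transversal H : is_subgroup H -> finite_index H ->
  exists n t c, @is_transversal H n t c.
Proof.
move=> HH [T [f fP]].
pose same x y := H (x^-1 * y).
have same_refl x : same x x by rewrite /same mulVg; exact: subgroup1.
have same_sym x y : same x y -> same y x.
  by rewrite /same => /(subgroupV HH); rewrite invgM invgK.
have same_trans x y z : same x y -> same y z -> same x z.
  rewrite /same => Hxy Hyz; have := subgroupM HH Hxy Hyz.
  by rewrite -mulgA mulVKg.
pose c0 x := f (xget 1 (same x)).
have c0P x y : c0 x = c0 y -> same x y.
  move=> /fP E; have sx : same x (xget 1 (same x)) by apply: (xgetPex 1); exists x.
  have sy : same y (xget 1 (same y)) by apply: (xgetPex 1); exists y.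
  by apply: (same_trans _ _ _ sx); apply: (same_trans _ _ _ E); exact: same_sym.
have c0E x y : same x y -> c0 x = c0 y.
  move=> xy; rewrite /c0; congr (f (xget 1 _)).
  apply/seteqP; split=> z; first exact: (same_trans _ _ _ (same_sym _ _ xy)).
  exact: same_trans.
pose A := [set u : T | `[< exists x, c0 x = u >]]%SET.
have cA x : c0 x \in A by rewrite inE; apply/asboolP; exists x.
have [t tP] : exists t : 'I_#|A| -> G, forall i, c0 (t i) = enum_val i.
  have [i|t tP] := @boolp.choice _ _ (fun (i : 'I_#|A|) x => c0 x = enum_val i); last by exists t.
  by have := enum_valP i; rewrite inE => /asboolP.
exists #|A|, t, (fun x => enum_rank_in (cA 1) (c0 x)); split.
- by move=> x; apply/same_sym/same_sym/c0P; rewrite tP enum_rankK_in.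
- by move=> x y /c0E ->.
- by move=> i; rewrite tP enum_valK_in.
Qed.

(** The group acts on the [n] cosets through permutations of [p]-power order,
    which form a [p]-group; the action is transitive, so [n] divides the order
    of this [p]-group. *)
Lemma transversal_pow p H n t c : prime p -> p_normal p H -> @is_transversal H n t c ->
  exists m, n = (p ^ m)%N.
Proof.
move=> p_pr pH tc; have [nH _ [e eP]] := pH.
have cP := transversalP nH tc.
have actP x : injective (fun i => c (x^-1 * t i)).
  move=> i j /cP; rewrite invgM invgK -mulgA mulVKg => /cP.
  by rewrite !(transversalK tc).
pose act x : {perm 'I_n} := perm (@actP x).
have actE x y : c (x^-1 * y) = act x (c y).
  rewrite permE; apply/cP; rewrite invgM invgK -mulgA mulVKg.
  apply/cP; by rewrite (transversalK tc).
have actM x y : act (x * y) = (act x * act y)%g.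
  by apply/permP=> i; rewrite -(transversalK tc i) permM -!actE mulgA invgM.
have act1 : act 1 = 1%g.
  by apply/permP=> i; rewrite -(transversalK tc i) perm1 -actE invg1 mul1g.
have actX x k : act (x ^+ k) = (act x ^+ k)%g.
  by elim: k => [|k IH]; rewrite ?expg0 // !expgS actM IH.
(* the group of permutations induced on the cosets *)
pose D := [set s : {perm 'I_n} | `[< exists x, act x = s >]]%SET.
have gD : group_set D.
  apply/group_setP; split; first by rewrite !inE; exists 1.
  move=> s s'; rewrite !inE => -[x <-] [y <-].
  by exists (x * y).
pose DG := Group gD.
have pD : p.-group DG.
  rewrite -pnat_exponent; apply: (@pnat_dvd _ (p ^ e)); last by rewrite pnatX pnat_id.
  apply/exponentP => s; rewrite !inE => -[x <-].
  rewrite -actX -act1; apply/permP => i; rewrite -(transversalK tc i) -!actE.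
  rewrite invg1 mul1g; apply: esym; apply/cP.
  have := eP x => /(subgroupV nH) /(normal_conj nH (t i)).
  by rewrite conjgE.
have tr : orbit 'P DG (c 1) = [set: 'I_n]%SET.
  apply/setP => i; rewrite inE; apply/orbitP.
  exists (act (t i)^-1); first by rewrite !inE; exists (t i)^-1.
  by rewrite /= /aperm -actE invgK mulg1 (transversalK tc).
have /p_natP [m] : p.-nat n.
  by have := card_orbit 'P DG (c 1); rewrite tr cardsT card_ord => ->;
     apply: pnat_dvd pD; exact: dvdn_indexg.
by move=> ->; exists m.
Qed.

Lemma transversal_leq H n t c B (x : 'I_B -> G) : is_subgroup H ->
  @is_transversal H n t c ->
  (forall i j, H ((x i)^-1 * x j) -> i = j) -> (B <= n)%N.
Proof.
move=> HH tc xP; have inj : injective (c \o x) by move=> i j /= /(transversalP HH tc) /xP.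
by have := leq_card _ inj; rewrite !card_ord.
Qed.

End SubgroupTheory.

(** * Free groups and quotient groups *)

Section FreeGroup.
Variable A : choiceType.
Implicit Types (l : A * bool) (w : seq (A * bool)).

Definition letter_inv l := (l.1, ~~ l.2).

Lemma letter_invK : involutive letter_inv.
Proof. by case=> a b; rewrite /letter_inv /= negbK. Qed.

Definition reduced w := sorted (fun l l' => l' != letter_inv l) w.

Definition push l w :=
  if w is l' :: w' then if l' == letter_inv l then w' else l :: w else [:: l].

Definition reduce w := foldr push [::] w.

Lemma push_reduced l w : reduced w -> reduced (push l w).
Proof.
case: w => [//|l' w] /= red_w; case: ifP => [_|/negbT ne]; first exact: path_sorted red_w.
by rewrite /reduced /= ne.
Qed.

Lemma foldr_push_reduced w c : reduced c -> reduced (foldr push c w).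
Proof. by move=> red_c; elim: w => //= l w; exact: push_reduced. Qed.

Lemma reduce_reduced w : reduced (reduce w).
Proof. exact: foldr_push_reduced. Qed.

Lemma push_id l w : reduced (l :: w) -> push l w = l :: w.
Proof. by case: w => [//|l' w] /andP[/negbTE /= ->]. Qed.

Lemma reduce_id w : reduced w -> reduce w = w.
Proof.
elim: w => [//|l w IH] red_w; rewrite /= IH ?push_id //.
exact: path_sorted red_w.
Qed.

Lemma pushK l w : reduced w -> push l (push (letter_inv l) w) = w.
Proof.
case: w => [|l' w] red_w; first by rewrite /= eqxx.
rewrite {2}/push letter_invK; case: eqP => [<-|_]; first exact: push_id.
by rewrite /= eqxx.
Qed.

Lemma pushVK l w : reduced w -> push (letter_inv l) (push l w) = w.
Proof. by move=> rw; rewrite -{2}[l]letter_invK pushK. Qed.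

(** Associativity of the product rests on this: acting by a word on reduced
    words depends only on the reduction of the word. *)
Lemma foldr_push_reduce w c : reduced c -> foldr push c (reduce w) = foldr push c w.
Proof.
move=> red_c; elim: w => [//|l w /= <-].
have := reduce_reduced w; case: (reduce w) => [//|l' s] red_s.
rewrite [X in foldr _ _ X]/push; case: eqP => [->|//] /=.
by rewrite pushK // foldr_push_reduced.
Qed.

Lemma reduce_catl w w' : reduce (reduce w ++ w') = reduce (w ++ w').
Proof. by rewrite /reduce !foldr_cat foldr_push_reduce // reduce_reduced. Qed.

Lemma reduce_catr w w' : reduce (w ++ reduce w') = reduce (w ++ w').
Proof. by rewrite /reduce !foldr_cat -/(reduce _) reduce_id // reduce_reduced. Qed.

Definition word_inv w := rev (map letter_inv w).

Lemma word_invK : involutive word_inv.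
Proof. by move=> w; rewrite /word_inv map_rev revK mapK //; exact: letter_invK. Qed.

Lemma reduce_invl w : reduce (word_inv w ++ w) = [::].
Proof.
elim: w => [//|l w IH]; rewrite /word_inv /= rev_cons cat_rcons.
rewrite /reduce foldr_cat /= -/(reduce w) pushVK ?reduce_reduced //.
by move: IH; rewrite /reduce foldr_cat.
Qed.

Record free_group := FreeElt { word_of :> seq (A * bool); word_ofP : reduced word_of }.
HB.instance Definition _ := [isSub for word_of].
HB.instance Definition _ := [Choice of free_group by <:].

Definition word w : free_group := FreeElt (reduce_reduced w).
Definition free_mul (x y : free_group) := word (x ++ y).
Definition free_inv (x : free_group) := word (word_inv x).

Lemma free_mulA : associative free_mul.
Proof. by move=> x y z; apply: val_inj; rewrite /= reduce_catl reduce_catr catA. Qed.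
Lemma free_mul1 : left_id (word [::]) free_mul.
Proof. by move=> x; apply: val_inj; rewrite /= reduce_id ?word_ofP. Qed.
Lemma free_mul1r : right_id (word [::]) free_mul.
Proof. by move=> x; apply: val_inj; rewrite /= cats0 reduce_id ?word_ofP. Qed.
Lemma free_mulV : left_inverse (word [::]) free_inv free_mul.
Proof. by move=> x; apply: val_inj; rewrite /= reduce_catl reduce_invl. Qed.
Lemma free_mulVr : right_inverse (word [::]) free_inv free_mul.
Proof.
move=> x; apply: val_inj; rewrite /= reduce_catr.
by rewrite -{1}[x : seq _]word_invK reduce_invl.
Qed.

HB.instance Definition _ := isGroup.Build free_group
  free_mulA free_mul1 free_mul1r free_mulV free_mulVr.

Local Open Scope group_scope.

Lemma word_cat w w' : word (w ++ w') = word w * word w'.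
Proof. by apply: val_inj; rewrite /= reduce_catl reduce_catr. Qed.

Lemma word_ofK (x : free_group) : word x = x.
Proof. by apply: val_inj; rewrite /= reduce_id ?word_ofP. Qed.

Lemma word_letter_inv l : word [:: letter_inv l] = (word [:: l])^-1.
Proof. exact: val_inj. Qed.

Definition free_gen (a : A) := word [:: (a, false)].

Lemma gen_free_gen : gen (range free_gen) = setT.
Proof.
apply/seteqP; split=> // x _; rewrite -(word_ofK x); elim: (word_of x) => [|l w IH].
  exact: gen_one.
rewrite -cat1s word_cat; apply: gen_mul => //.
case: l => a [|]; last by apply: gen_in; exists a.
rewrite -[(a, true)]/(letter_inv (a, false)) word_letter_inv.
by apply: gen_inv; apply: gen_in; exists a.
Qed.

End FreeGroup.

Section Quotient.
Local Open Scope group_scope.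
Variables (G : groupType) (N : set G) (nN : is_normal N).

(** The predicate depends only on the coset, so by extensionality [xget] picks
    the same representative for all of its elements. *)
Definition coset_rep (x : G) : G := xget 1 [set y | N (x^-1 * y)].

Lemma coset_repP x : N (x^-1 * coset_rep x).
Proof.
apply: (xgetPex 1 (P := [set y | N (x^-1 * y)])); exists x => /=.
by rewrite mulVg; exact: (subgroup1 nN).
Qed.

Lemma coset_rep_eq x y : N (x^-1 * y) -> coset_rep x = coset_rep y.
Proof.
move=> xy; rewrite /coset_rep; congr xget; apply/seteqP; split=> z /= Nz.
  have := subgroupM nN (subgroupV nN xy) Nz.
  by rewrite invgM invgK -mulgA mulVKg.
by have := subgroupM nN xy Nz; rewrite -mulgA mulVKg.
Qed.

Definition quotient_of (_ : is_normal N) := {x : G | coset_rep x == x}.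
HB.instance Definition _ := Choice.on (quotient_of nN).
Local Notation Q := (quotient_of nN).

Lemma coset_rep_id x : coset_rep (coset_rep x) == coset_rep x.
Proof. by apply/eqP/esym/coset_rep_eq/coset_repP. Qed.

Definition to_quot (x : G) : Q := exist _ (coset_rep x) (coset_rep_id x).

Lemma to_quot_eq x y : to_quot x = to_quot y <-> N (x^-1 * y).
Proof.
split=> [/(congr1 val) /= E|xy]; last by apply: val_inj; exact: coset_rep_eq.
have := coset_repP x; rewrite E => Nx.
have := subgroupM nN Nx (subgroupV nN (coset_repP y)).
by rewrite invgM invgK mulgA mulgK.
Qed.

Lemma val_quotK (u : Q) : to_quot (val u) = u.
Proof. by apply: val_inj => /=; exact/eqP/(valP u). Qed.

Definition quot_mul (u v : Q) := to_quot (val u * val v).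
Definition quot_inv (u : Q) := to_quot (val u)^-1.

Lemma quot_mulE x y : quot_mul (to_quot x) (to_quot y) = to_quot (x * y).
Proof.
apply/esym/to_quot_eq => /=; rewrite invgM -mulgA (mulgA x^-1).
have H := normal_conj nN y (coset_repP x).
have := subgroupM nN H (coset_repP y).
by rewrite conjgE -!mulgA mulVKg.
Qed.

Lemma quot_invE x : quot_inv (to_quot x) = to_quot x^-1.
Proof.
apply/to_quot_eq => /=; rewrite invgK; apply/(normal_mulC nN).
exact: coset_repP.
Qed.

Lemma quot_mulA : associative quot_mul.
Proof.
move=> u v w; rewrite -(val_quotK u) -(val_quotK v) -(val_quotK w).
by rewrite !quot_mulE mulgA.
Qed.
Lemma quot_mul1 : left_id (to_quot 1) quot_mul.
Proof. by move=> u; rewrite -(val_quotK u) quot_mulE mul1g. Qed.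
Lemma quot_mul1r : right_id (to_quot 1) quot_mul.
Proof. by move=> u; rewrite -(val_quotK u) quot_mulE mulg1. Qed.
Lemma quot_mulV : left_inverse (to_quot 1) quot_inv quot_mul.
Proof. by move=> u; rewrite -(val_quotK u) quot_invE quot_mulE mulVg. Qed.
Lemma quot_mulVr : right_inverse (to_quot 1) quot_inv quot_mul.
Proof. by move=> u; rewrite -(val_quotK u) quot_invE quot_mulE mulgV. Qed.

HB.instance Definition _ := isGroup.Build Q
  quot_mulA quot_mul1 quot_mul1r quot_mulV quot_mulVr.

Record is_quotient (P : groupType) (f : G -> P) : Prop := IsQuotient {
  quotientM : {morph f : x y / x * y};
  quotient_surj : forall u, exists x, f x = u;
  quotient_ker : forall x, f x = 1 <-> N x }.

(** Only the universal description of the quotient is used afterwards, never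
    its construction. *)
Lemma quotient_exists : exists (P : groupType) (f : G -> P), is_quotient f.
Proof.
exists Q, to_quot; split.
- by move=> x y; rewrite -quot_mulE.
- by move=> u; exists (val u); exact: val_quotK.
- move=> x; split=> [/esym/to_quot_eq|Nx]; first by rewrite invg1 mul1g.
  by apply/esym/to_quot_eq; rewrite invg1 mul1g.
Qed.

End Quotient.

Section QuotientTheory.
Local Open Scope group_scope.
Variables (G P : groupType) (N : set G) (f : G -> P).
Hypothesis fQ : is_quotient N f.

Lemma quotient1 : f 1 = 1.
Proof. by apply: (mulgI (f 1)); rewrite -(quotientM fQ) !mulg1. Qed.

Lemma quotientV x : f x^-1 = (f x)^-1.
Proof. by apply/esym; apply: mulg1_eq; rewrite -(quotientM fQ) mulgV quotient1. Qed.

Lemma quotientX x n : f (x ^+ n) = f x ^+ n.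
Proof. by elim: n => [|n IH]; rewrite ?expg0 ?quotient1 // !expgS (quotientM fQ) IH. Qed.

Lemma quotientJ x y : f (x ^ y) = f x ^ f y.
Proof. by rewrite !conjgE !(quotientM fQ) quotientV. Qed.

Lemma quotient_eq x y : f x = f y <-> N (x^-1 * y).
Proof.
rewrite -(quotient_ker fQ) (quotientM fQ) quotientV; split=> [->|]; first exact: mulVg.
by move=> E; have := mulg1_eq E; rewrite invgK.
Qed.

End QuotientTheory.

(** * Finite generation of finite-index subgroups *)

Section FiniteGeneration.
Local Open Scope group_scope.
Variable G : groupType.
Implicit Types (H K L : set G).

Lemma transversalMr H n t c x y z : is_normal H -> @is_transversal G H n t c ->
  c x = c y -> c (x * z) = c (y * z).
Proof.
move=> nH tc /(transversalP nH tc) xy; apply/(transversalP nH tc).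
have := normal_conj nH z xy; by rewrite conjgE invgM !mulgA.
Qed.

Definition generated_by H (ys : seq G) := [set` ys] `<=` H /\ H `<=` gen [set` ys].

(** Pulling a word back to the transversal after each letter, [t v * x * (t (c
    (t v * x)))^-1] is multiplicative along paths of cosets, so the finitely
    many values at the generators generate all of its values, in particular
    [H] up to conjugation by [t (c 1)]. *)
Lemma schreier (I : finType) (s : I -> G) H :
  gen (range s) = setT -> is_normal H -> finite_index H ->
  exists ys, generated_by H ys.
Proof.
move=> genS nH /(finite_index_transversal nH)[n [t [c tc]]].
pose sch (v : 'I_n) x := t v * x * (t (c (t v * x)))^-1.
pose v0 := c 1.
have t0H : H (t v0).
  by apply: (subgroupVE nH); have := transversal_rep tc 1; rewrite mulg1.
have schH v x : H (sch v x).
  by apply: (normal_mulC nH); exact: (transversal_rep tc).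
pose ys := t v0 :: [seq sch vi.1 (s vi.2) | vi : 'I_n * I].
exists ys; split.
  move=> x /=; rewrite inE => /orP[/eqP->//|/mapP[[v i] _ ->]] /=; exact: schH.
have schM v x y : sch v (x * y) = sch v x * sch (c (t v * x)) y.
  rewrite /sch; set v' := c (t v * x).
  have -> : c (t v' * y) = c (t v * (x * y)).
    by rewrite mulgA; apply: (transversalMr _ nH tc); rewrite (transversalK tc).
  by rewrite -!mulgA mulKg.
have sch1 v : sch v 1 = 1 by rewrite /sch mulg1 (transversalK tc) mulgV.
have schgen x : gen (range s) x -> forall v, gen [set` ys] (sch v x).
  elim=> [v|_ [i _ <-] v|{}x y _ IHx _ IHy v|{}x _ IHx v].
  - by rewrite sch1; exact: gen_one.
  - by apply: gen_in; rewrite /= inE; apply/orP; right; apply/mapP;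
       exists (v, i) => //; rewrite mem_enum.
  - by rewrite schM; exact: gen_mul.
  - set v' := c (t v * x^-1).
    have E : c (t v' * x) = v.
      rewrite -[RHS](transversalK tc) -[t v in RHS](mulgVK x).
      by apply: (transversalMr _ nH tc); rewrite (transversalK tc).
    have := schM v' x x^-1; rewrite mulgV sch1 E => /esym E1.
    have <- : (sch v' x)^-1 = sch v x^-1 by exact: mulg1_eq E1.
    exact: gen_inv.
move=> x Hx; have gx : gen (range s) x by rewrite genS.
have := schgen _ gx v0; rewrite /sch.
have -> : c (t v0 * x) = v0.
  apply: (transversal_eq tc); rewrite mulg1; apply: (subgroupV nH).
  exact: (subgroupM nH).
have gt : gen [set` ys] (t v0) by apply: gen_in; rewrite /= mem_head.
have sg := gen_subgroup [set` ys].
by move=> /(subgroupMr sg (subgroupV sg gt)) /(subgroupMl sg gt).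
Qed.

Lemma finite_reps_index H (R : seq G) :
  (forall x, exists2 r, r \in R & H (r^-1 * x)) -> is_subgroup H -> finite_index H.
Proof.
move=> RP HH; have [r rP] := @boolp.choice _ _ (fun x r => r \in R /\ H (r^-1 * x))
  (fun x => let: ex_intro2 r a b := RP x in ex_intro _ r (conj a b)).
exists 'I_(size R).+1, (fun x => inord (index (r x) R)) => x y.
move=> /(congr1 val) /=; rewrite !inordK ?ltnS ?index_size // => E.
have {}E : r x = r y.
  by rewrite -(nth_index 1 (rP x).1) E nth_index //; exact: (rP y).1.
have := subgroupM HH (subgroupV HH (rP x).2) (rP y).2.
by rewrite E invgM invgK -mulgA mulVKg.
Qed.

Lemma commute_gen S y x : (forall s, S s -> commute y s) -> gen S x -> @commute G y x.
Proof.
move=> yS; elim=> [|s|a b _ ya _ yb|a _ ya].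
- exact: commute1.
- exact: yS.
- exact: commuteM.
- exact: commuteV.
Qed.

(** Every element is a product of powers of the generators with exponents less
    than [q]; by induction on the list of generators. *)
Lemma commuting_torsion_finite q (ys : seq G) : (0 < q)%N ->
  {in ys &, forall x y, commute x y} -> {in ys, forall y, y ^+ q = 1} ->
  exists R : seq G, gen [set` ys] `<=` [set` R].
Proof.
move=> q_gt0; elim: ys => [|y ys IH] com tor.
  exists [:: 1] => x; elim=> [||a b _ /= /[!inE]/eqP-> _ /eqP->|a _ /= /[!inE]/eqP->] //=.
  - by rewrite inE.
  - by rewrite mulg1.
  - by rewrite invg1.
have [||R RP] := IH.
- by move=> a b ha hb; apply: com; rewrite inE ?ha ?hb orbT.
- by move=> a ha; apply: tor; rewrite inE ha orbT.
exists [seq y ^+ a * r | a <- iota 0 q, r <- R] => x gx.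
have yq : y ^+ q = 1 by apply: tor; rewrite mem_head.
have comy h : gen [set` ys] h -> commute y h.
  by apply: commute_gen => s sys; apply: com; rewrite inE ?eqxx // sys orbT.
(* since y commutes with everything, its powers can be collected in front *)
have [a [h [gh ->]]] : exists a h, gen [set` ys] h /\ x = y ^+ a * h.
  elim: gx => [|s|u v _ [a [h [gh ->]]] _ [b [k [gk ->]]]|u _ [a [h [gh ->]]]].
  - by exists 0%N, 1; split; [exact: gen_one|rewrite expg0 mulg1].
  - rewrite /= inE => /predU1P[->|sys].
      by exists 1%N, 1; split; [exact: gen_one|rewrite expg1 mulg1].
    by exists 0%N, s; split; [exact: gen_in|rewrite expg0 mul1g].
  - exists (a + b)%N, (h * k); split; first exact: gen_mul.
    rewrite expgnDr -!mulgA; congr (_ * _); rewrite !mulgA; congr (_ * _).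
    by apply: (@commuteX _ h y b); apply: commute_sym; exact: comy.
  (* natural exponents suffice: y^-a = y^(a (q - 1)) as y^q = 1 *)
  - exists (a * q.-1)%N, h^-1; split; first exact: gen_inv.
    rewrite invgM.
    have -> : (y ^+ a)^-1 = y ^+ (a * q.-1).
      apply: mulg1_eq; rewrite -expgnDr -mulnS prednK //.
      by rewrite mulnC expgnA yq expg1n.
    by apply: commuteX; apply: commute_sym; apply: commuteV; exact: comy.
apply/allpairsP; exists ((a %% q)%N, h); split => //=.
- by rewrite mem_iota add0n ltn_mod.
- exact: RP.
- by rewrite {1}(divn_eq a q) expgnDr mulnC expgnA yq expg1n mul1g.
Qed.

End FiniteGeneration.

Section AbelianExtension.
Local Open Scope group_scope.
Variable G : groupType.
Implicit Types (H K L : set G).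

(** The quotient [K / L] is abelian, finitely generated and of finite
    exponent, hence finite. *)
Lemma p_normal_abelian_ext p j K L ys : prime p -> p_normal p K -> is_normal L ->
  L `<=` K -> generated_by K ys -> commutators K `<=` L ->
  (forall k, K k -> L (k ^+ (p ^ j)%N)) -> p_normal p L.
Proof.
move=> p_pr [nK fiK [e eP]] nL LK [ysK Kys] comL tor; split=> //; last first.
  by exists (e + j)%N => x; rewrite expnD expgnA; apply: tor; exact: eP.
have [n [t [c tc]]] := finite_index_transversal nK fiK.
have [P [f fQ]] := quotient_exists nL.
have [|||R RP] := @commuting_torsion_finite P (p ^ j) (map f ys).
- by rewrite expn_gt0 prime_gt0.
- move=> u v /mapP[x xys ->] /mapP[y yys ->].
  rewrite /commute -!(quotientM fQ); apply/(quotient_eq fQ).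
  apply: comL; apply: gen_in; exists y, x; split; try exact: ysK.
  by rewrite invgM /commg /conjg !mulgA.
- move=> u /mapP[x xys ->]; rewrite -(quotientX fQ); apply/(quotient_ker fQ).
  exact/tor/ysK.
have [g gP] := @boolp.choice _ _ (fun u x => f x = u) (quotient_surj fQ).
apply: (finite_reps_index (R := [seq t i * g r | i <- enum 'I_n, r <- R]) _ nL) => x.
have /Kys gk := transversal_rep tc x; set k := _ * x in gk.
have fk : gen [set` map f ys] (f k).
  elim: gk => [|y yys|u v _ IHu _ IHv|u _ IHu].
  - by rewrite (quotient1 fQ); exact: gen_one.
  - by apply: gen_in => /=; exact: map_f.
  - by rewrite (quotientM fQ); exact: gen_mul.
  - by rewrite (quotientV fQ); exact: gen_inv.
exists (t (c x) * g (f k)).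
  apply/allpairsP; exists (c x, f k); split=> //=; first by rewrite mem_enum.
  exact: RP.
rewrite invgM -mulgA -/k; apply/(quotient_eq fQ); exact: gP.
Qed.

End AbelianExtension.

(** * Integration of cochains along words *)

Section Holonomy.
Variables (A : choiceType) (T : Type).
Local Notation F := (free_group A).
Variable act : T -> F -> T.
Hypothesis act1 : forall v, act v 1%g = v.
Hypothesis actM : forall v x y, act v (x * y)%g = act (act v x) y.
Implicit Types (e : T * A -> rat) (v : T) (l : A * bool) (w : seq (A * bool)) (x y : F).

(** A cochain is given on the edges labelled by generators; an inverse letter
    runs along the edge that ends at the current vertex, backwards. *)
Definition edge_val e v l :=
  if l.2 then - e (act v (word [:: l]), l.1) else e (v, l.1).

Fixpoint path_sum e v w :=
  if w is l :: w' then edge_val e v l + path_sum e (act v (word [:: l])) w' else 0.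

Lemma path_sum_cat e v w w' :
  path_sum e v (w ++ w') = path_sum e v w + path_sum e (act v (word w)) w'.
Proof.
elim: w v => [|l w IH] v /=.
  by rewrite add0r -[word [::]]/(1%g : F) act1.
by rewrite IH addrA -(cat1s l w) word_cat actM.
Qed.

Lemma path_sum_push e v l w : path_sum e v (push l w) = path_sum e v (l :: w).
Proof.
case: w => [//|l' w] /=; case: eqP => [->|//].
rewrite word_letter_inv -actM mulgV act1 addrA.
(* the edge is run through forth and back *)
have -> : edge_val e v l + edge_val e (act v (word [:: l])) (letter_inv l) = 0.
  case: l => a [] /=; rewrite /edge_val /=.
    by rewrite addrC subrr.
  by rewrite (word_letter_inv (a, false) : word [:: (a, true)] = _) -actM mulgV act1 subrr.
by rewrite add0r.
Qed.

Lemma path_sum_reduce e v w : path_sum e v (reduce w) = path_sum e v w.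
Proof. by elim: w v => [//|l w IH] v; rewrite /= path_sum_push /= IH. Qed.

Definition holonomy e v x := path_sum e v (word_of x).

Lemma holonomyM e v x y : holonomy e v (x * y)%g = holonomy e v x + holonomy e (act v x) y.
Proof. by rewrite /holonomy /= path_sum_reduce path_sum_cat word_ofK. Qed.

Lemma holonomyV e v x : holonomy e v x^-1%g = - holonomy e (act v x^-1%g) x.
Proof. by apply/eqP; rewrite -addr_eq0 -holonomyM mulVg. Qed.

Lemma holonomy_gen e v a : holonomy e v (free_gen a) = e (v, a).
Proof. by rewrite /holonomy /= addr0. Qed.

Lemma holonomyX e v x k :
  holonomy e v (x ^+ k)%g = \sum_(i < k) holonomy e (act v (x ^+ i)%g) x.
Proof.
elim: k => [|k IH]; first by rewrite big_ord0.
by rewrite expgSr holonomyM IH big_ord_recr.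
Qed.

Lemma holonomy_linear a e e' v x :
  holonomy (fun u => a * e u + e' u) v x = a * holonomy e v x + holonomy e' v x.
Proof.
rewrite /holonomy; elim: (word_of x) v => [|l w IH] v /=; first by rewrite mulr0 addr0.
rewrite IH !mulrDr addrACA; congr (_ + _).
by rewrite /edge_val; case: ifP; rewrite ?mulrN ?opprD.
Qed.

Lemma holonomy_int e v x : (forall u, e u \is a Num.int) -> holonomy e v x \is a Num.int.
Proof.
move=> eint; rewrite /holonomy; elim: (word_of x) v => [|l w IH] v //=.
by apply: rpredD => //; rewrite /edge_val; case: ifP => _; rewrite ?rpredN.
Qed.

(** If [x] loops at the end of a path, going there and back cancels: the
    integral along a conjugate is the integral of [x] at another base point.
    *)
Lemma holonomy_conj e v x y : act (act v y^-1%g) x = act v y^-1%g ->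
  holonomy e v (x ^ y)%g = holonomy e (act v y^-1%g) x.
Proof.
by move=> fix_x; rewrite conjgE !holonomyM fix_x holonomyV [X in _ + X]addrC addKr.
Qed.

End Holonomy.

(** * Counting homomorphisms to the rationals *)

Record has_order (G : groupType) (K : set G) (x : G) (q : nat) : Prop := HasOrder {
  order_gt0 : (0 < q)%N;
  order_in : K (x ^+ q)%g;
  order_min : forall o, (0 < o)%N -> K (x ^+ o)%g -> (q <= o)%N }.

Section CosetAction.
Variables (G : groupType) (K : set G) (nK : is_normal K).
Variables (n : nat) (t : 'I_n -> G) (c : G -> 'I_n).
Hypothesis tc : is_transversal K t c.
Implicit Types (v : 'I_n) (x y : G).

Definition coset_act v x : 'I_n := c (t v * x)%g.

Lemma coset_act1 v : coset_act v 1%g = v.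
Proof. by rewrite /coset_act mulg1 (transversalK tc). Qed.

Lemma coset_actM v x y : coset_act v (x * y)%g = coset_act (coset_act v x) y.
Proof.
rewrite /coset_act mulgA; apply: (transversalMr _ nK tc).
by rewrite (transversalK tc).
Qed.

Lemma coset_act_fix v x : coset_act v x = v <-> K x.
Proof.
rewrite /coset_act -{2}(transversalK tc v) (transversalP nK tc) invgM -mulgA mulVg mulg1.
by split=> [/(subgroupVE nK)|/(subgroupV nK)].
Qed.

Lemma coset_act_base v : coset_act (c 1%g) (t v) = v.
Proof.
rewrite /coset_act -[RHS](transversalK tc) -[in RHS](mul1g (t v)).
by apply: (transversalMr _ nK tc); rewrite (transversalK tc).
Qed.

Lemma coset_act_inj x : injective (coset_act ^~ x).
Proof.
by move=> u v /(congr1 (coset_act ^~ x^-1%g)); rewrite -!coset_actM mulgV !coset_act1.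
Qed.

Definition coset_perm x : {perm 'I_n} := perm (@coset_act_inj x).

Lemma coset_permX x v k : iter k (coset_perm x) v = coset_act v (x ^+ k)%g.
Proof.
elim: k => [|k IH]; first by rewrite coset_act1.
by rewrite iterS IH permE -coset_actM -expgSr.
Qed.

Lemma card_porbit_coset x q v : has_order K x q -> #|porbit (coset_perm x) v| = q.
Proof.
move=> [q_gt0 Kq q_min]; set o := #|_|; apply/eqP; rewrite eqn_leq; apply/andP; split.
  (* if q were less than the orbit size, v would occur twice in its own orbit
     *)
  have := uniq_traject_porbit (coset_perm x) v; rewrite -/o leqNgt => Uo.
  apply/negP => lt_qo; move: Uo; rewrite -(subnKC (ltnW lt_qo)) trajectD.
  have : (0 < o - q)%N by rewrite subn_gt0.
  case: (o - q)%N => // r _; rewrite cat_uniq /= => /and3P[_ /negP[]].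
  rewrite coset_permX (coset_act_fix v _).2 //.
  by rewrite -(prednK q_gt0) /= mem_head.
apply: q_min; first by rewrite lt0n card_porbit_neq0.
by apply/(coset_act_fix v); rewrite -coset_permX iter_porbit.
Qed.

(** All orbits of [x] on the cosets have exactly [q] elements, since
    stabilizers are the powers of [x] that lie in the normal subgroup [K]. *)
Lemma card_porbits_coset x q : has_order K x q ->
  (#|porbits (coset_perm x)| * q)%N = n.
Proof.
move=> xq; rewrite -[RHS]card_ord -[RHS]sum1_card.
rewrite (partition_big (porbit (coset_perm x)) (mem (porbits (coset_perm x)))) /=; last first.
  by move=> v _; exact: imset_f.
rewrite -sum_nat_const; apply: eq_bigr => B /imsetP[w _ ->].
rewrite -(card_porbit_coset w xq) -sum1_card.
by apply: eq_bigl => v; rewrite /= eq_porbit_mem.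
Qed.

Lemma sum_porbit (S : nmodType) (f : 'I_n -> S) x q v : has_order K x q ->
  \sum_(u in porbit (coset_perm x) v) f u = \sum_(i < q) f (coset_act v (x ^+ i)%g).
Proof.
move=> xq; have po := porbit_traject (coset_perm x) v.
have uq := uniq_traject_porbit (coset_perm x) v.
rewrite (card_porbit_coset v xq) in po uq.
rewrite (eq_bigl (mem (traject (coset_perm x) v q))); last exact: po.
rewrite -big_uniq //= (big_nth v) size_traject big_mkord.
by apply: eq_bigr => i _; rewrite nth_traject // coset_permX.
Qed.

End CosetAction.

Lemma dim_cap_lker (k : fieldType) (V : vectType k) m (f : {linear V -> 'rV[k]_m})
    (U : {vspace V}) :
  (\dim U <= \dim (U :&: lker (linfun f)) + m)%N.
Proof.
rewrite -(limg_ker_dim (linfun f) U) leq_add2l -[m in (_ <= m)%N]mul1n.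
by rewrite -[(1 * m)%N](dim_matrix k 1 m) -dimvf; apply: dimvS; exact: subvf.
Qed.

Section CochainCount.
Variables (A : finType) (K : set (free_group A)) (nK : is_normal K).
Variables (n : nat) (t : 'I_n -> free_group A) (c : free_group A -> 'I_n).
Hypothesis tc : is_transversal K t c.
Local Notation F := (free_group A).
Local Notation T := 'I_n.
Local Notation cochain := {ffun T * A -> rat^o}.
Local Notation act := (coset_act t c).
Local Notation hol := (holonomy act).
Implicit Types (e : cochain) (v : T) (x y : F).

Let act1 := coset_act1 tc.
Let actM := coset_actM nK tc.
Let v0 : T := c 1%g.

Definition period e x := hol e v0 x.

Lemma holonomy_ffun_linear v x : linear (fun e : cochain => hol e v x : rat^o).
Proof.
move=> a e e'; rewrite -[RHS](holonomy_linear act a e e').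
by congr holonomy; apply/funext => u; rewrite !ffunE.
Qed.

Lemma periodM e x y : K x -> period e (x * y)%g = period e x + period e y.
Proof.
move=> Kx; rewrite /period (holonomyM act1 actM).
by congr (_ + hol _ _ _); apply/(coset_act_fix nK tc).
Qed.

(** A cochain without periods is the coboundary of its integral from the base
    point: the edge closes up to a loop, which belongs to [K], with the paths
    to its two ends. *)
Lemma coboundary e : (forall k, K k -> period e k = 0) ->
  forall v a, e (v, a) = hol e v0 (t (act v (free_gen a))) - hol e v0 (t v).
Proof.
move=> e0 v a; set u := act v _.
have vE : act v0 (t v) = v := coset_act_base nK tc v.
have uE : act v0 (t u) = u := coset_act_base nK tc u.
have uV : act u (t u)^-1%g = v0 by rewrite -{1}uE -actM mulgV act1.
have /e0 : K (t v * free_gen a * (t u)^-1)%g.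
  by apply/(coset_act_fix nK tc v0); rewrite !actM vE -/u.
rewrite /period !(holonomyM act1 actM) !actM vE holonomy_gen -/u.
rewrite (holonomyV act1 actM) uV.
by move=> /eqP; rewrite subr_eq0 => /eqP <-; rewrite addrC addKr.
Qed.

Section OrbitSums.
Variable x : F.

(** The linear conditions under which a cochain integrates to zero along [x ^
    q] from any vertex: one for each orbit of [x]. *)
Definition orbit_sums e : 'rV[rat]_#|porbits (coset_perm nK tc x)| :=
  \row_(i < #|porbits (coset_perm nK tc x)|) \sum_(u in (enum_val i : {set T})) hol e u x.

Fact orbit_sums_linear : linear orbit_sums.
Proof.
move=> a e e'; apply/rowP => i; rewrite !mxE mulr_sumr -big_split /=.
by apply: eq_bigr => u _; rewrite holonomy_ffun_linear.
Qed.
HB.instance Definition _ := GRing.isLinear.Build rat cochain _ _ orbit_sums orbit_sums_linear.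

(** The path [x ^ q] visits each vertex of an orbit exactly once. *)
Lemma orbit_sums_holonomy e q v : has_order K x q -> orbit_sums e = 0 ->
  hol e v (x ^+ q)%g = 0.
Proof.
move=> xq /rowP e0; rewrite (holonomyX act1 actM) -(sum_porbit nK tc (fun u => hol e u x) v xq).
have Bin : porbit (coset_perm nK tc x) v \in porbits (coset_perm nK tc x) by exact: imset_f.
by have := e0 (enum_rank_in Bin (porbit (coset_perm nK tc x) v)); rewrite !mxE enum_rankK_in.
Qed.

End OrbitSums.

Section Functionals.
Variables (nb : nat) (fam : 'I_nb -> seq (rat * F)).

Definition eval_functionals e : 'rV[rat]_nb :=
  \row_i \sum_(s <- fam i) s.1 * period e s.2.

Fact eval_functionals_linear : linear eval_functionals.
Proof.
move=> a e e'; apply/rowP => i; rewrite !mxE mulr_sumr -big_split /=.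
by apply: eq_bigr => u _; rewrite /period holonomy_ffun_linear mulrDr mulrCA.
Qed.
HB.instance Definition _ := GRing.isLinear.Build rat cochain _ _
  eval_functionals eval_functionals_linear.

End Functionals.

Definition delta (f : {ffun T -> rat^o}) : cochain :=
  [ffun u => f (act u.1 (free_gen u.2)) - f u.1].

Fact delta_linear : linear delta.
Proof.
move=> a f g; apply/ffunP => u; rewrite !ffunE scalerBr opprD addrACA.
by rewrite -!scalerN.
Qed.
HB.instance Definition _ := GRing.isLinear.Build rat _ _ _ delta delta_linear.

(** Each relator costs as many conditions as there are orbits, that is, [n]
    divided by the order. *)
Lemma relator_space (rels : seq (F * nat)) :
  {in rels, forall r, has_order K r.1 r.2} ->
  exists U : {vspace cochain},
    (forall e, e \in U -> {in rels, forall r, forall v, hol e v (r.1 ^+ r.2)%g = 0}) /\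
    n%:R * (#|A|%:R - \sum_(r <- rels) r.2%:R^-1) <= (\dim U)%:R :> rat.
Proof.
elim: rels => [|r rels IH] ord_rels.
  exists fullv; split=> // ; rewrite big_nil subr0 dimvf -natrM ler_nat.
  by rewrite [X in (_ <= X)%N]/dim /=  muln1 card_prod card_ord.
have [|U [U0 Udim]] := IH; first by move=> s srels; apply: ord_rels; rewrite inE srels orbT.
have ord_r : has_order K r.1 r.2 by apply: ord_rels; rewrite mem_head.
exists (U :&: lker (linfun (orbit_sums r.1)))%VS; split.
  move=> e; rewrite memv_cap memv_ker lfunE => /andP[eU /eqP er] s.
  rewrite inE => /predU1P[-> v|srels]; last exact: U0.
  exact: (orbit_sums_holonomy v ord_r er).
have := dim_cap_lker (orbit_sums r.1) U; move=> le_dim.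
rewrite big_cons opprD addrCA mulrDr [X in X <= _]addrC mulrN lerBlDr.
apply: le_trans Udim _.
rewrite -[in n%:R / _](card_porbits_coset nK tc ord_r) natrM mulfK; last first.
  by rewrite pnatr_eq0 -lt0n; exact: order_gt0 ord_r.
by rewrite -natrD ler_nat.
Qed.

(** Rank-nullity: cochains have dimension [n * #|A|], the coboundaries at most
    [n], and the functionals [fam] separate what is left. *)
Lemma period_count (rels : seq (F * nat)) nb (fam : 'I_nb -> seq (rat * F)) :
  {in rels, forall r, has_order K r.1 r.2} ->
  (forall e, {in rels, forall r, forall v, hol e v (r.1 ^+ r.2)%g = 0} ->
     (forall i, \sum_(s <- fam i) s.1 * period e s.2 = 0) ->
     forall k, K k -> period e k = 0) ->
  n%:R * (#|A|%:R - 1 - \sum_(r <- rels) r.2%:R^-1) <= nb%:R :> rat.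
Proof.
move=> ord_rels Kvan; have [U [U0 Udim]] := relator_space ord_rels.
pose W := (U :&: lker (linfun (eval_functionals fam)))%VS.
have Wdelta : (W <= limg (linfun delta))%VS.
  apply/subvP => e; rewrite memv_cap memv_ker lfunE => /andP[eU /eqP/rowP e0].
  have /coboundary eE : forall k, K k -> period e k = 0.
    apply: Kvan => [|i]; first exact: U0.
    by have := e0 i; rewrite !mxE.
  apply/memv_imgP; exists [ffun v => hol e v0 (t v)]; rewrite ?memvf // lfunE.
  by apply/ffunP => -[v a]; rewrite !ffunE /= eE.
have Wdim : (\dim W <= n)%N.
  apply: leq_trans (dimvS Wdelta) _.
  have dT : \dim {: {ffun T -> rat^o}} = n by rewrite dimvf /dim /= muln1 card_ord.
  apply: (@leq_trans (\dim {: {ffun T -> rat^o}})); last by rewrite dT.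
  by rewrite -(limg_ker_dim (linfun delta) fullv) leq_addl.
have := dim_cap_lker (eval_functionals fam) U; rewrite -/W => Wle.
rewrite addrAC mulrBr mulr1 lerBlDr -natrD.
apply: le_trans Udim _; rewrite ler_nat addnC.
by apply: leq_trans Wle _; rewrite leq_add2r.
Qed.

End CochainCount.

(** * Homomorphisms that kill a normal closure of powers *)

Section PartialHom.
Variables (G : groupType) (K : set G) (sK : is_subgroup K).

Definition hom_on (phi : G -> rat) :=
  forall x y, K x -> K y -> phi (x * y)%g = phi x + phi y.

Variables (phi : G -> rat) (phiM : hom_on phi).

Lemma hom_on1 : phi 1%g = 0.
Proof.
have K1 := subgroup1 sK; have := phiM K1 K1; rewrite mulg1 => /eqP.
by rewrite -subr_eq0 opprD addrA subrr sub0r oppr_eq0 => /eqP.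
Qed.

Lemma hom_onV x : K x -> phi x^-1%g = - phi x.
Proof.
move=> Kx; apply/eqP; rewrite -addr_eq0 -phiM ?mulVg ?hom_on1 //.
exact: subgroupV.
Qed.

Lemma hom_onX x k : K x -> phi (x ^+ k)%g = k%:R * phi x.
Proof.
move=> Kx; elim: k => [|k IH]; first by rewrite expg0 hom_on1 mul0r.
by rewrite expgS phiM ?IH ?[in RHS]mulrSr ?mulrDl ?mul1r 1?addrC //; exact: subgroupX.
Qed.

Lemma hom_on_commutators x : commutators K x -> phi x = 0.
Proof.
move=> Dx; suff: [set x | K x /\ phi x = 0] x by case.
apply: gen_min Dx => [|z [u [v [Ku Kv ->]]]].
  split; first by split; [exact: subgroup1|exact: hom_on1].
    move=> u v [Ku u0] [Kv v0]; split; first exact: subgroupM.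
    by rewrite phiM // u0 v0 addr0.
  by move=> u [Ku u0]; split; [exact: subgroupV|rewrite hom_onV // u0 oppr0].
have KuV := subgroupV sK Ku; have KvV := subgroupV sK Kv.
have Kuv := subgroupM sK Ku Kv; have Kvuv := subgroupM sK KvV Kuv.
split; first by rewrite /commg /conjg; exact: subgroupM.
by rewrite /commg /conjg !phiM // !hom_onV // addrCA addKr addNr.
Qed.

Lemma hom_on_gen (S : set G) (V : set rat) :
  V 0 -> (forall a b, V a -> V b -> V (a + b)) -> (forall a, V a -> V (- a)) ->
  S `<=` K -> (forall x, S x -> V (phi x)) -> forall x, gen S x -> V (phi x).
Proof.
move=> V0 VD VN SK SV x Sx; suff: [set x | K x /\ V (phi x)] x by case.
apply: gen_min Sx => [|z Sz]; last by split; [exact: SK|exact: SV].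
split; first by split; [exact: subgroup1|rewrite hom_on1].
  move=> u v [Ku u0] [Kv v0]; split; first exact: subgroupM.
  by rewrite phiM //; exact: VD.
by move=> u [Ku u0]; split; [exact: subgroupV|rewrite hom_onV //; exact: VN].
Qed.

End PartialHom.

Section NormalClosure.
Variable G : groupType.
Implicit Types (rels : seq (G * nat)) (K : set G).

Definition relator_closure rels : set G :=
  gen [set z | exists r y, r \in rels /\ z = ((r.1 ^+ r.2) ^ y)%g].

Lemma relator_closure_normal rels : is_normal (relator_closure rels).
Proof.
by apply: gen_normal => z y [r [y' [rr ->]]]; exists r, (y' * y)%g; rewrite conjgM.
Qed.

Lemma relator_closure_sub rels K : is_normal K ->
  {in rels, forall r, K (r.1 ^+ r.2)%g} -> relator_closure rels `<=` K.
Proof.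
move=> nK relK; apply: gen_min => [|z [r [y [rr ->]]]]; first exact: nK.
exact/(normal_conj nK)/relK.
Qed.

Lemma relator_closure_in rels r : r \in rels -> relator_closure rels (r.1 ^+ r.2)%g.
Proof. by move=> rr; apply: gen_in; exists r, 1%g; rewrite conjg1. Qed.

Lemma relator_closureS rels rels' : {subset rels <= rels'} ->
  relator_closure rels `<=` relator_closure rels'.
Proof. by move=> sub; apply: gen_sub => z [r [y [/sub rr ->]]]; exists r, y. Qed.

Lemma relator_closure_order rels K : is_normal K ->
  {in rels, forall r, has_order K r.1 r.2} -> relator_closure rels `<=` K.
Proof. by move=> nK oK; apply: relator_closure_sub => // r /oK []. Qed.

End NormalClosure.

(** The dimension of the space of homomorphisms that kill the relators is
    bounded below through the number of functionals [fam], finite combinations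
    of evaluations, needed to detect them; a basis of the first homology
    provides such functionals. Only homomorphisms of bounded denominators need
    be detected: it is for these that vanishing on the intersection of the
    chain can be proved. *)
Lemma hom_count (A : finType) (K : set (free_group A)) n t c
    (rels : seq (free_group A * nat)) nb (fam : 'I_nb -> seq (rat * free_group A)) :
  is_normal K -> @is_transversal _ K n t c ->
  {in rels, forall r, has_order K r.1 r.2} ->
  (forall phi : free_group A -> rat, hom_on K phi ->
     (forall x, relator_closure rels x -> phi x = 0) ->
     (exists2 D : rat, D != 0 & forall x, D * phi x \is a Num.int) ->
     (forall i, \sum_(s <- fam i) s.1 * phi s.2 = 0) ->
     forall k, K k -> phi k = 0) ->
  n%:R * (#|A|%:R - 1 - \sum_(r <- rels) r.2%:R^-1) <= nb%:R :> rat.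
Proof.
move=> nK tc ord_rels Kvan; apply: (period_count nK tc ord_rels (fam := fam)) => e e_rels e_fam.
have actM := coset_actM nK tc; have act1 := coset_act1 tc.
have homK : hom_on K (period t c e) by move=> x y Kx _; exact: (periodM nK tc).
apply: Kvan => // [x|].
- apply: (hom_on_gen nK homK (V := [set 0])) => //.
  + by move=> a b -> ->; rewrite /= addr0.
  + by move=> a ->; rewrite /= oppr0.
  + by move=> z [r [y [/ord_rels rK ->]]]; apply: (normal_conj nK); case: rK.
  + move=> z [r [y [rr ->]]] /=; have [_ Kr _] := ord_rels r rr.
    rewrite /period (holonomy_conj act1 actM) ?e_rels //.
    exact/(coset_act_fix nK tc).
- pose D : rat := \prod_(u : 'I_n * A) (denq (e u))%:~R.
  exists D; first by apply/prodf_neq0 => u _; rewrite intr_eq0 denq_neq0.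
  (* D e = (D - 1) e + e has integer values *)
  move=> x; have := holonomy_linear (coset_act t c) (D - 1) e e (c 1%g) x.
  rewrite mulrBl mul1r subrK /period => <-; apply: holonomy_int => u.
  rewrite mulrBl mul1r subrK /D (bigD1 u) //= mulrAC mulrC.
  rewrite (_ : (denq (e u))%:~R * e u = (numq (e u))%:~R); last first.
    by rewrite -[in X in _ * X = _](divq_num_den (e u)) mulrC divfK // intr_eq0 denq_neq0.
  by rewrite rpredM ?intr_int // rpred_prod // => v _; rewrite intr_int.
Qed.

(** * One stage of the construction *)

Section PowerOrders.
Local Open Scope group_scope.
Variables (G : groupType) (p : nat) (p_pr : prime p).
Implicit Types (K Q : set G) (x : G).

(** The set of exponents [o] with [x ^ o] in [K] is closed under gcd, so the
    least power of [p] in it is its least positive element. *)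
Lemma has_order_pow K x : p_normal p K -> exists m, has_order K x (p ^ m).
Proof.
move=> [nK _ [e eP]].
have ex : exists m, `[< K (x ^+ (p ^ m)%N) >] by exists e; apply/asboolP.
case: (ex_minnP ex) => m /asboolP Km m_min; exists m; split=> //.
  by rewrite expn_gt0 prime_gt0.
move=> o o_gt0 Ko; apply: dvdn_leq => //.
have /(dvdn_pfactor _ _ p_pr)[i le_im gE] := dvdn_gcdr o (p ^ m).
suff : K (x ^+ (p ^ i)%N).
  move=> Ki; have /m_min le_mi : `[< K (x ^+ (p ^ i)%N) >] by apply/asboolP.
  have -> : m = i by apply/eqP; rewrite eqn_leq le_mi.
  by rewrite -gE dvdn_gcdl.
(* Bezout: the gcd is a combination of o and p^m *)
rewrite -gE; case: (egcdnP (p ^ m) o_gt0) => km kn E _.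
apply: (subgroupMl nK (x := x ^+ (kn * p ^ m)%N)).
  by rewrite mulnC expgnA; exact: (subgroupX _ nK).
by rewrite -expgnDr -E mulnC expgnA; exact: (subgroupX _ nK).
Qed.

(** Intersecting finitely many subgroups, one for each [c] of unbounded order,
    treats all [c] at once. *)
Lemma avoid_powers (M K : set G) N (cs : seq G) : p_normal p K -> M `<=` K ->
  exists Q, [/\ p_normal p Q, M `<=` Q, Q `<=` K &
    forall c, c \in cs ->
      (exists m, forall Q', p_normal p Q' -> M `<=` Q' -> Q' (c ^+ (p ^ m)%N)) \/
      ~ Q (c ^+ (p ^ N)%N)].
Proof.
move=> pK MK; elim: cs => [|c cs [Q [pQ MQ QK QP]]]; first by exists K; split.
have [tor|] := pselect (exists m, forall Q', p_normal p Q' -> M `<=` Q' -> Q' (c ^+ (p ^ m)%N)).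
  by exists Q; split=> // c'; rewrite inE => /predU1P[->|/QP//]; left.
move=> /forallNP /(_ N) /existsNP[Q' /not_implyP[pQ' /not_implyP[MQ' nQ']]].
exists (Q `&` Q'); split.
- exact: p_normalI.
- by move=> x Mx; split; [exact: MQ|exact: MQ'].
- by move=> x [/QK].
- move=> c'; rewrite inE => /predU1P[->|/QP[tor|nQ]]; first by right=> -[].
    by left.
  by right=> -[].
Qed.

End PowerOrders.

Section ProductDecomposition.
Local Open Scope group_scope.
Variable G : groupType.
Implicit Types (M D K : set G) (ys : seq G).

Definition prod3 M W D : set G :=
  [set x | exists m w c, [/\ M m, W w, D c & x = m * w * c]].

Lemma prod3_subgroup M W D : is_normal M -> is_subgroup W -> is_normal D ->
  is_subgroup (prod3 M W D).
Proof.
move=> nM sW nD; split.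
- exists 1, 1, 1; split; rewrite ?mulg1 //.
  + exact: (subgroup1 nM).
  + exact: (subgroup1 sW).
  + exact: (subgroup1 nD).
- move=> _ _ [m [w [c [Mm Ww Dc ->]]]] [m' [w' [c' [Mm' Ww' Dc' ->]]]].
  exists (m * m' ^ (w * c)^-1), (w * w'), (c ^ w' * c'); split.
  + by apply: (subgroupM nM) => //; exact: (normal_conj nM).
  + exact: (subgroupM sW).
  + by apply: (subgroupM nD) => //; exact: (normal_conj nD).
  + by rewrite !conjgE invgK !invgM !mulgA !(mulgK, mulgVK).
- move=> _ [m [w [c [Mm Ww Dc ->]]]].
  exists (m^-1 ^ (w * c)), w^-1, (c^-1 ^ w^-1); split.
  + by apply: (normal_conj nM); exact: (subgroupV nM).
  + exact: (subgroupV sW).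
  + by apply: (normal_conj nD); exact: (subgroupV nD).
  + by rewrite !conjgE !invgK !invgM !mulgA !(mulgK, mulgVK).
Qed.

(** Modulo commutators, taking [q]-th powers is a homomorphism, so the powers
    of the generators generate all [q]-th powers. *)
Lemma power_decomposition K ys q k : is_normal K -> generated_by K ys -> K k ->
  exists w c, [/\ gen [set` [seq y ^+ q | y <- ys]] w, commutators K c & k ^+ q = w * c].
Proof.
move=> nK [ysK Kys] Kk; have nD := commutators_normal nK.
have [P [f fQ]] := quotient_exists nD.
set W := gen _.
suff [w [Ww fw]] : exists w, W w /\ f (k ^+ q) = f w.
  exists w, (w^-1 * k ^+ q); split; rewrite ?mulVKg //.
  by apply/(quotient_eq fQ).
have com u v : K u -> K v -> commute (f u) (f v).
  move=> Ku Kv; rewrite /commute -!(quotientM fQ); apply/(quotient_eq fQ).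
  by apply: gen_in; exists v, u; split=> //; rewrite invgM /commg /conjg !mulgA.
suff [] : [set k | K k /\ exists w, W w /\ f (k ^+ q) = f w] k by [].
apply: gen_min (Kys _ Kk); last first.
  move=> y yys; split; first exact: ysK.
  by exists (y ^+ q); split=> //; apply: gen_in => /=; apply/mapP; exists y.
split.
- split; first exact: (subgroup1 nK).
  by exists 1; split; [exact: gen_one|rewrite expg1n].
- move=> u v [Ku [w [Ww fu]]] [Kv [w' [Ww' fv]]]; split; first exact: (subgroupM nK).
  exists (w * w'); split; first exact: gen_mul.
  rewrite (quotientX fQ) !(quotientM fQ) (expgMn _ (com _ _ Ku Kv)).
  by rewrite -!(quotientX fQ) fu fv.
- move=> u [Ku [w [Ww fu]]]; split; first exact: (subgroupV nK).
  exists w^-1; split; first exact: gen_inv.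
  by rewrite (quotientX fQ) !(quotientV fQ) expVgn -(quotientX fQ) fu.
Qed.

End ProductDecomposition.

Section Step.
Variables (A : finType) (p : nat) (p_pr : prime p) (eps : rat).
Hypotheses (A_gt1 : (1 < #|A|)%N) (eps_lt1 : eps < 1).
Local Notation F := (free_group A).
Implicit Types (K L : set F) (rels : seq (F * nat)).

(** [rels] lists pairs of a base [x] and an exponent [q], standing for the
    relator [x ^ q]. The bound on the sum keeps the dimension count of
    [hom_count] above [#|A| - 1 - eps]. *)
Record admissible K rels : Prop := Admissible {
  admissible_normal : p_normal p K;
  admissible_order : {in rels, forall r, has_order K r.1 r.2};
  admissible_sum : \sum_(r <- rels) r.2%:R^-1 < eps }.

(** Iterating [next_hom] makes a rational homomorphism of bounded denominators
    that kills the relators vanish on the intersection of the chain. By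
    [next_growth], the first homology of [L] is spanned by the classes of [ys]
    once the [cs] have become torsion, and the factor [B] makes their number
    negligible against the index. *)
Record next_stage (B : nat) K rels L K' rels' : Prop := NextStage {
  next_L : p_normal p L;
  next_LK : L `<=` K;
  next_K'L : K' `<=` L;
  next_rels : {subset rels <= rels'};
  next_hom : forall phi : F -> rat, hom_on K phi ->
    (forall x, relator_closure rels x -> phi x = 0) ->
    (forall x, relator_closure rels' x -> phi x = 0) /\
    (forall x, K' x -> exists2 y, K y & phi x = p%:R * phi y);
  next_growth : exists ys cs : seq F,
    [/\ [set` ys] `<=` L, [set` cs] `<=` L,
        L `<=` gen (relator_closure rels `|` [set` ys] `|` [set` cs]),
        {in cs, forall c, exists m, forall Q, p_normal p Q ->
           relator_closure rels' `<=` Q -> Q (c ^+ (p ^ m)%N)%g} &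
        forall n t c, @is_transversal _ L n t c -> (size ys * B <= n)%N] }.

(** The dimension count with no functionals at all: if every homomorphism
    killing the relators were zero, then [#|A| - 1] would be at most the sum
    of the inverse orders, which is less than [1]. *)
Lemma nonzero_hom K rels : admissible K rels ->
  exists2 phi : F -> rat, hom_on K phi &
    [/\ forall x, relator_closure rels x -> phi x = 0,
        forall x, K x -> phi x \is a Num.int &
        exists2 k, K k & phi k != 0].
Proof.
move=> [pK ordK sumK]; have nK := p_normal_normal pK.
have [n [t [c tc]]] := finite_index_transversal nK (p_normal_finite pK).
have n_gt0 : (0 < n)%N by have := c 1%g => -[m]; exact: leq_ltn_trans.
apply: contrapT => noK.
have := hom_count (fam := fun _ : 'I_0 => [::]) nK tc ordK.
case/(_ _)/Wrap => [phi homK phi0 [D D0 Dint] _ k Kk|].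
  apply: contrapT => phik; apply: noK; exists (fun x => D * phi x).
    by move=> x y Kx Ky; rewrite homK // mulrDr.
  split=> //; first by move=> x /phi0 ->; rewrite mulr0.
  by exists k => //; rewrite mulf_neq0 //; apply/eqP.
move=> [le0]; have : 0 < n%:R * (#|A|%:R - 1 - \sum_(r <- rels) r.2%:R^-1) :> rat.
  rewrite mulr_gt0 ?ltr0n //.
  have : 2 <= #|A|%:R :> rat by rewrite ler_nat.
  by move: sumK eps_lt1; lra.
by rewrite ltNge le0.
Qed.

(** The subgroup [L] is [M K^(p^j) [K, K]] with [j] large, and [K'] is a
    smaller subgroup modulo which the commutators [cs] have large order or are
    known to be torsion. *)
Lemma stage_step B K rels : admissible K rels ->
  exists L K' rels', admissible K' rels' /\ next_stage B K rels L K' rels'.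
Proof.
move=> gK; have [pK ordK sumK] := gK; have nK := p_normal_normal pK.
have [ys0 ys0K] := schreier (gen_free_gen A) nK (p_normal_finite pK).
have [phi0 homphi0 [phi0M phi0int [k0 Kk0 phik0]]] := nonzero_hom gK.
set M := relator_closure rels.
have nM : is_normal M by exact: relator_closure_normal.
have MK : M `<=` K by exact: relator_closure_order.
set D := commutators K; have nD : is_normal D by exact: commutators_normal.
have DK : D `<=` K by apply: commutators_sub; exact: nK.
have /intrP[a aE] := phi0int _ Kk0.
pose N0 := (size ys0 * B)%N.
(* phi0 takes multiples of p^j on L and the value a at k0; with p^j > |a| N0
   the powers k0^i, i < N0, are distinct modulo L *)
pose j := (`|a| * N0).+1.
have p_gt1 := prime_gt1 p_pr.
have lt_j : (`|a| * N0 < p ^ j)%N by apply: ltn_trans (ltn_expl _ p_gt1).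
pose powK := [set (k ^+ (p ^ j))%g | k in K].
pose L := gen (M `|` powK `|` D).
have nL : is_normal L.
  apply: gen_normal => x y [[Mx|[k Kk <-]]|Dx].
  - by left; left; exact: (normal_conj nM).
  - by left; right; exists (k ^ y)%g; rewrite ?conjXg //; exact: (normal_conj nK).
  - by right; exact: (normal_conj nD).
have SK : M `|` powK `|` D `<=` K.
  move=> x [[/MK//|[k Kk <-]]|/DK//]; exact: (subgroupX _ nK).
have LK : L `<=` K by apply: gen_min SK; exact: nK.
have pL : p_normal p L.
  apply: (p_normal_abelian_ext p_pr pK nL LK ys0K).
    by move=> x Dx; apply: gen_in; right.
  by move=> k Kk; apply: gen_in; left; right; exists k.
(* phi kills M and the commutators, and turns p^j-th powers into multiples *)
have homL phi : hom_on K phi -> (forall x, M x -> phi x = 0) ->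
    forall x, L x -> exists2 y, K y & phi x = (p ^ j)%:R * phi y.
  move=> hphi phiM x Lx.
  apply: (hom_on_gen nK hphi (V := [set u | exists2 y, K y & u = (p ^ j)%:R * phi y])) Lx => //=.
  - by exists 1%g; [exact: (subgroup1 nK)|rewrite (hom_on1 nK) ?mulr0].
  - move=> _ _ [y Ky ->] [z Kz ->]; exists (y * z)%g; first exact: (subgroupM nK).
    by rewrite hphi // mulrDr.
  - move=> _ [y Ky ->]; exists (y^-1)%g; first exact: (subgroupV nK).
    by rewrite (hom_onV nK hphi) // mulrN.
  - have zero y : phi y = 0 -> exists2 y0, K y0 & phi y = (p ^ j)%:R * phi y0.
      by exists 1%g; [exact: (subgroup1 nK)|rewrite (hom_on1 nK) ?mulr0].
    move=> y [[/phiM/zero//|[k Kk <-]]|Dy]; last exact/zero/(hom_on_commutators nK hphi).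
    by exists k => //; rewrite (hom_onX nK hphi).
have Lindex n t c : @is_transversal _ L n t c -> (N0 <= n)%N.
  move=> tc; apply: (transversal_leq (x := fun i : 'I_N0 => (k0 ^+ i)%g) nL tc) => i i'.
  wlog le_ii' : i i' / (i <= i')%N.
    move=> IH Lii'; case: (leqP i i') => [|/ltnW] le; first exact: IH.
    apply/esym/IH => //; apply: (subgroupVE nL); by rewrite invgM invgK.
  move=> Lii'; apply/val_inj/eqP; rewrite /= eqn_leq le_ii' /= -subn_eq0 -leqn0.
  have : L (k0 ^+ (i' - i))%g.
    by rewrite -(subnKC le_ii') expgnDr mulKg in Lii'.
  move=> /(homL _ homphi0 phi0M)[y Ky].
  rewrite (hom_onX nK homphi0) // aE.
  have /intrP[b ->] := phi0int _ Ky.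
  rewrite -[(i' - i)%:R]/((i' - i)%:Z%:~R) -[(p ^ j)%:R]/((p ^ j)%:Z%:~R) -!intrM.
  move=> /intr_inj /(congr1 absz); rewrite !abszM !absz_nat => E.
  have dvd : (p ^ j %| (i' - i) * `|a|)%N by rewrite E dvdn_mulr.
  rewrite leqNgt; apply/negP => lt0; move/dvdn_leq: dvd; rewrite muln_gt0 lt0 absz_gt0.
  have -> : a != 0 by move: phik0; rewrite aE intr_eq0.
  move=> /(_ isT); rewrite leqNgt => /negP[]; apply: leq_ltn_trans lt_j.
  rewrite mulnC leq_mul2l; apply/orP; right.
  by apply: leq_trans (leq_subr _ _) _; exact: ltnW.
have [zs [zsL Lzs]] := schreier (gen_free_gen A) nL (p_normal_finite pL).
pose ys := [seq (y ^+ (p ^ j))%g | y <- ys0].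
(* modulo commutators, L is generated by M and the p^j-th powers of the
   generators of K *)
have Ldec z : L z -> exists c, D c /\ gen (M `|` [set` ys]) (z * c^-1)%g.
  move=> Lz; suff [m [w [c [Mm Ww Dc ->]]]] : prod3 M (gen [set` ys]) D z.
    exists c; split=> //; rewrite mulgK; apply: gen_mul; first by apply: gen_in; left.
    by apply: gen_sub Ww => y yys; right.
  have sP := prod3_subgroup nM (gen_subgroup [set` ys]) nD.
  apply: gen_min Lz => // x [[Mx|[k Kk <-]]|Dx].
  - exists x, 1%g, 1%g; split; rewrite ?mulg1 //; first exact: gen_one.
    exact: (subgroup1 nD).
  - have [w [c [Ww Dc ->]]] := power_decomposition (p ^ j) nK ys0K Kk.
    by exists 1%g, w, c; split; rewrite ?mul1g //; exact: (subgroup1 nM).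
  - exists 1%g, 1%g, x; split; rewrite ?mul1g //; first exact: (subgroup1 nM).
    exact: gen_one.
have CP z : exists c, L z -> D c /\ gen (M `|` [set` ys]) (z * c^-1)%g.
  have [/Ldec[c cP]|nLz] := pselect (L z); first by exists c.
  by exists 1%g => /nLz.
have {CP}[C CP] := boolp.choice CP.
pose cs := [seq C z | z <- zs].
have csD : [set` cs] `<=` D.
  by move=> c /= /mapP[z zzs ->]; apply: (CP z _).1; exact: zsL.
have ML : M `<=` L by move=> x Mx; apply: gen_in; left; left.
have DL : D `<=` L by move=> x Dx; apply: gen_in; right.
(* bases of new relators will have order at least p^N1, so that the inverses
   of their orders fit in the slack left under eps *)
have [N1 N1P] : exists N, (size cs)%:R / (p ^ N)%:R < eps - \sum_(r <- rels) r.2%:R^-1 :> rat.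
  set del := _ - _; have del0 : 0 < del by rewrite subr_gt0.
  exists (Num.bound ((size cs)%:R / del)).
  rewrite ltr_pdivrMr ?ltr0n ?expn_gt0 ?prime_gt0 // mulrC -ltr_pdivrMr //.
  apply: lt_le_trans (archi_boundP _) _; first by rewrite divr_ge0 // ltW.
  by rewrite ler_nat; apply/ltnW/ltn_expl.
have [K' [pK' MK' K'L K'cs]] := avoid_powers N1 cs pL ML.
have [ord ordP] := @boolp.choice _ _ (fun x m => has_order K' x (p ^ m))
  (fun x => has_order_pow p_pr x pK').
(* an element that gets no relator is torsion already, by K'cs *)
pose new := [seq (c, (p ^ ord c)%N) | c <- cs & `[< ~ K' (c ^+ (p ^ N1)%N)%g >]].
have K'K : K' `<=` K by apply: subset_trans LK.
exists L, K', (new ++ rels); split; first split=> //.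
- move=> r; rewrite mem_cat => /orP[/mapP[c _ ->]|rr]; first exact: ordP.
  have [q_gt0 _ qmin] := ordK _ rr; split=> //; first exact/MK'/relator_closure_in.
  by move=> o o_gt0 /K'K; exact: qmin.
- rewrite big_cat /= -ltrBrDr; apply: le_lt_trans N1P.
  rewrite big_map big_filter.
  apply: (@le_trans _ _ (\sum_(c <- cs) ((p ^ N1)%:R)^-1)); last first.
    by rewrite big_const_seq count_predT iter_addr_0 mulr_natl.
  rewrite [leRHS](bigID (fun c => `[< ~ K' (c ^+ (p ^ N1)%N)%g >])) /= -[leLHS]addr0.
  apply: lerD; last by apply: sumr_ge0 => c _; rewrite invr_ge0.
  apply: ler_sum => c /asboolP nK'c.
  rewrite lef_pV2 ?posrE ?ltr0n ?expn_gt0 ?prime_gt0 // ler_nat leq_exp2l //.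
  rewrite leqNgt; apply/negP => /ltnW le_ordN; apply: nK'c.
  rewrite -(subnKC le_ordN) expnD expgnA; apply: (subgroupX _ pK').
  by case: (ordP c).
split=> //.
- by move=> r rr; rewrite mem_cat rr orbT.
- move=> phi hphi phiM; split=> [x|x /K'L /(homL _ hphi phiM)[y Ky ->]]; last first.
    exists (y ^+ (p ^ j.-1))%g; first exact: (subgroupX _ nK).
    by rewrite (hom_onX nK hphi) // mulrA -natrM -expnS.
  move=> Mx; suff : [set x | K x /\ phi x = 0] x by case.
  move: Mx; apply: gen_min => [|z [r [y [rr ->]]]].
    split; first by split; [exact: (subgroup1 nK)|exact: (hom_on1 nK)].
      move=> u v [Ku u0] [Kv v0]; split; first exact: (subgroupM nK).
      by rewrite hphi // u0 v0 addr0.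
    by move=> u [Ku u0]; split; [exact: (subgroupV nK)|rewrite (hom_onV nK) // u0 oppr0].
  move: rr; rewrite mem_cat => /orP[/mapP[c]|rr].
    (* a new relator is a conjugate of a power of a commutator element *)
    rewrite mem_filter => /andP[_ /csD Dc] -> /=.
    have Dz : D ((c ^+ (p ^ ord c)) ^ y)%g by apply: (normal_conj nD); exact: (subgroupX _ nD).
    by split; [exact: DK|exact: (hom_on_commutators nK)].
  have Mz : M ((r.1 ^+ r.2) ^ y)%g by apply: gen_in; exists r, y.
  by split; [exact: MK|exact: phiM].
- exists ys, cs; split.
  + move=> y /= /mapP[y0 y0ys ->]; apply: gen_in; left; right; exists y0 => //.
    exact: ys0K.1.
  + by move=> c /csD/DL.
  + move=> x /Lzs; apply: gen_min; first exact: gen_subgroup.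
    move=> z zzs; rewrite -(mulgVK (C z) z); apply: gen_mul.
      by apply: gen_sub (CP z (zsL _ zzs)).2 => u; left.
    by apply: gen_in; right; apply/mapP; exists z.
  + move=> c ccs; have [[m tor]|nK'c] := K'cs c ccs.
      exists m => Q pQ MQ; apply: tor => // x Mx; apply: MQ.
      by apply: relator_closureS Mx => r rr; rewrite mem_cat rr orbT.
    exists (ord c) => Q pQ; apply; apply: (relator_closure_in (r := (c, (p ^ ord c)%N))).
    rewrite mem_cat; apply/orP; left; apply/mapP; exists c => //.
    by rewrite mem_filter ccs andbT; apply/asboolP.
  + by move=> n t c /Lindex; rewrite size_map.
Qed.

End Step.

(** * The infinite chain and its intersection *)

Section Tower.
Variables (A : finType) (p : nat) (p_pr : prime p) (eps : rat).
Hypotheses (A_gt1 : (1 < #|A|)%N) (eps_gt0 : 0 < eps) (eps_lt1 : eps < 1).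
Local Notation F := (free_group A).

Record tower (K L : nat -> set F) (rels : nat -> seq (F * nat)) : Prop := Tower {
  tower0 : K 0%N = setT;
  tower_admissible : forall i, admissible p eps (K i) (rels i);
  tower_next : forall i, next_stage p i.+2 (K i) (rels i) (L i) (K i.+1) (rels i.+1) }.

Lemma admissible_free : admissible p eps [set: F] [::].
Proof.
split=> //; last by rewrite big_nil.
split=> //; last by exists 0%N.
by exists unit, (fun=> tt).
Qed.

Lemma tower_exists : exists K L rels, tower K L rels.
Proof.
pose stage := {s : set F * seq (F * nat) | admissible p eps s.1 s.2}.
have step (u : nat * stage) : exists Ls : set F * stage,
    next_stage p u.1.+2 (sval u.2).1 (sval u.2).2 Ls.1 (sval Ls.2).1 (sval Ls.2).2.
  case: u => i [[K rels] /= gK].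
  have [L [K' [rels' [gK' nK']]]] := stage_step p_pr A_gt1 eps_lt1 i.+2 gK.
  by exists (L, exist _ (K', rels') gK').
have [next nextP] := boolp.choice step.
pose s0 : stage := exist _ ([set: F], [::]) admissible_free.
pose s := fix s i := if i is i'.+1 then (next (i', s i')).2 else s0.
exists (fun i => (sval (s i)).1), (fun i => (next (i, s i)).1), (fun i => (sval (s i)).2).
by split=> // i; [case: (s i)|exact: (nextP (i, s i))].
Qed.

Variables (K L : nat -> set F) (rels : nat -> seq (F * nat)).
Hypothesis tw : tower K L rels.

Let nextP := tower_next tw.

Lemma tower_normal i : p_normal p (K i).
Proof. exact: admissible_normal (tower_admissible tw i). Qed.

Lemma tower_sub i j : (i <= j)%N -> K j `<=` K i.
Proof.
move=> /subnKC <-; elim: (j - i)%N => [|k IH]; first by rewrite addn0.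
rewrite addnS; apply: subset_trans IH; apply: subset_trans (next_LK (nextP _)).
exact: next_K'L (nextP _).
Qed.

Lemma tower_rels i j : (i <= j)%N -> {subset rels i <= rels j}.
Proof.
move=> /subnKC <-; elim: (j - i)%N => [|k IH] r; first by rewrite addn0.
by move/IH; rewrite addnS; exact: (next_rels (nextP _)).
Qed.

Lemma tower_relators i j : relator_closure (rels i) `<=` K j.
Proof.
have sub k : relator_closure (rels k) `<=` K k.
  exact: relator_closure_order (tower_normal k) (admissible_order (tower_admissible tw k)).
have [le_ij|/ltnW le_ji] := leqP i j.
  exact: subset_trans (relator_closureS (tower_rels le_ij)) (sub j).
exact: subset_trans (sub i) (tower_sub le_ji).
Qed.

Definition tower_cap : set F := [set x | forall i, K i x].

Lemma tower_cap_normal : is_normal tower_cap.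
Proof.
split; first split.
- by move=> i; apply: subgroup1; exact: tower_normal.
- by move=> x y Kx Ky i; apply: subgroupM => //; exact: tower_normal.
- by move=> x Kx i; apply: subgroupV => //; exact: tower_normal.
- by move=> x y Kx i; apply: normal_conj => //; exact: tower_normal.
Qed.

(** All [K j] contain the relators of stage [i], also those with [j < i]. *)
Lemma tower_cap_torsion i c m :
  (forall Q, p_normal p Q -> relator_closure (rels i) `<=` Q -> Q (c ^+ (p ^ m))%g) ->
  tower_cap (c ^+ (p ^ m))%g.
Proof.
by move=> tor j; apply: tor; [exact: tower_normal|exact: tower_relators].
Qed.

Lemma tower_hom i (phi : F -> rat) : hom_on (K i) phi ->
  (forall x, relator_closure (rels i) x -> phi x = 0) ->
  forall x, tower_cap x -> forall m, exists2 y, K i y & phi x = (p ^ m)%:R * phi y.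
Proof.
move=> homphi phi0 x Nx m.
suff [_ H] : (forall x, relator_closure (rels (i + m)) x -> phi x = 0) /\
    forall x, K (i + m) x -> exists2 y, K i y & phi x = (p ^ m)%:R * phi y by exact: H.
elim: m => [|m [IH0 IH]].
  by rewrite addn0; split=> // z Kz; exists z; rewrite ?mul1r.
have homm : hom_on (K (i + m)) phi.
  by move=> u v /(tower_sub (leq_addr m i)) Ku /(tower_sub (leq_addr m i)) Kv; exact: homphi.
rewrite addnS; have [H0 H] := next_hom (nextP (i + m)) homm IH0; split=> // z /H[y /IH[u Ku ->] ->].
by exists u => //; rewrite mulrA -natrM -expnS.
Qed.

(** On [N] the values are divisible by all powers of [p] among rationals of
    bounded denominator. *)
Lemma tower_hom_cap i (phi : F -> rat) (D : rat) : hom_on (K i) phi ->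
  (forall x, relator_closure (rels i) x -> phi x = 0) ->
  D != 0 -> (forall x, D * phi x \is a Num.int) ->
  forall x, tower_cap x -> phi x = 0.
Proof.
move=> homphi phi0 D0 Dint x Nx; apply: contrapT => /eqP phix.
have /intrP[a aE] := Dint x.
(* p^|a| divides a only if a = 0 *)
have [y _ yE] := tower_hom homphi phi0 Nx `|a|%N.
have /intrP[b bE] := Dint y.
have a0 : a != 0 by rewrite -(intr_eq0 rat) -aE mulf_neq0.
have : a = (p ^ `|a|)%:Z * b.
  apply: (@intr_inj rat); rewrite intrM -aE -bE yE mulrCA; congr (_ * _).
move=> /(congr1 absz); rewrite abszM absz_nat => E.
have := dvdn_mulr `|b| (dvdnn (p ^ `|a|)%N); rewrite -E => /dvdn_leq.
by rewrite absz_gt0 a0 leqNgt ltn_expl ?prime_gt1 // => /(_ isT).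
Qed.

Definition tower_chain n : set F := if odd n then L n./2 else K n./2.

Lemma tower_chain_even i : tower_chain (2 * i) = K i.
Proof. by rewrite /tower_chain mul2n odd_double doubleK. Qed.

Lemma tower_chain_odd i : tower_chain (2 * i).+1 = L i.
Proof. by rewrite /tower_chain mul2n /= odd_double /= uphalf_double. Qed.

Lemma tower_chain_normal n : p_normal p (tower_chain n).
Proof.
rewrite /tower_chain; case: ifP => _; last exact: tower_normal.
exact: next_L (nextP _).
Qed.

Lemma tower_chain_sub n : tower_chain n.+1 `<=` tower_chain n.
Proof.
have [i [->|->]] : exists i, n = (2 * i)%N \/ n = (2 * i).+1.
  exists n./2; rewrite -{1 3}(odd_double_half n) mul2n.
  by case: (odd n); [right|left].
- rewrite tower_chain_odd tower_chain_even; exact: next_LK (nextP _).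
- rewrite tower_chain_odd -addn2 -{2}[2%N]muln1 -mulnDr addn1 tower_chain_even.
  exact: next_K'L (nextP _).
Qed.

Lemma tower_cap_chain x : tower_cap x <-> forall n, (1 <= n)%N -> tower_chain n x.
Proof.
split=> [Nx n _|H i].
  rewrite /tower_chain; case: ifP => // _; exact: (next_K'L (nextP _) (Nx _)).
apply: (tower_sub (leqnSn i)); rewrite -tower_chain_even; apply: H.
by rewrite mulnS.
Qed.

End Tower.

(** * Bases of a quotient of a vector space *)

Section LinearExtension.
Variables (k : fieldType) (I : choiceType) (W : lmodType k) (h : I -> W).
Local Notation C := (monalg.malg I k).
Implicit Types x y : C.

Definition lin_ext x : W := \sum_(g <- monalg.msupp x) monalg.mcoeff g x *: h g.

Lemma lin_extEw (D : {fset I}) x : (monalg.msupp x `<=` D)%fset ->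
  lin_ext x = \sum_(g <- D) monalg.mcoeff g x *: h g.
Proof.
move=> sub; apply: big_fset_incl => // g _ gx.
by rewrite monalg.mcoeff_outdom // scale0r.
Qed.

Fact lin_ext_linear : linear lin_ext.
Proof.
move=> a x y; pose D := (monalg.msupp (a *: x + y) `|` (monalg.msupp x `|` monalg.msupp y))%fset.
rewrite !(@lin_extEw D) /D ?fsubsetUl //; last first.
- by rewrite fsetUCA fsubsetUl.
- by rewrite fsetUA fsubsetUr.
rewrite scaler_sumr -big_split /=; apply: eq_bigr => g _.
by rewrite monalg.mcoeffD monalg.mcoeffZ scalerDl scalerA.
Qed.
HB.instance Definition _ := GRing.isLinear.Build k C W _ lin_ext lin_ext_linear.

Lemma lin_extU g : lin_ext (monalg.mkmalgU g 1) = h g.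
Proof.
rewrite /lin_ext monalg.msuppU oner_eq0 big_seq_fset1.
by rewrite monalg.mcoeffUU scale1r.
Qed.

End LinearExtension.

Lemma malg_ind (k : fieldType) (I : choiceType) (P : monalg.malg I k -> Prop) :
  P 0 -> (forall x y, P x -> P y -> P (x + y)) -> (forall a x, P x -> P (a *: x)) ->
  (forall g, P (monalg.mkmalgU g 1)) -> forall x, P x.
Proof.
move=> P0 PD PZ PU x; rewrite (monalg.monalgE x); elim/big_ind: _ => // g _.
have -> : monalg.mkmalgU g (monalg.mcoeff g x) = monalg.mcoeff g x *: monalg.mkmalgU g 1.
  by apply/monalg.malgP => g'; rewrite monalg.mcoeffZ !monalg.mcoeffU mulrnAr mulr1.
exact: PZ.
Qed.

Lemma alternating_sum3 (k : fieldType) (V : lmodType k) (F : 'I_3 -> V) :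
  \sum_(i < 3) (-1) ^+ i *: F i = F ord0 - F (lift ord0 ord0) + F ord_max.
Proof.
rewrite big_ord_recl big_ord_recl big_ord1 /= expr0 expr1 scale1r scaleN1r.
rewrite (_ : (-1) ^+ _ = 1 :> k) ?scale1r ?addrA; last by rewrite /bump /= sqrrN expr1n.
by congr (_ + F _); apply: val_inj.
Qed.

Section SpanModulo.
Variables (k : fieldType) (V : lmodType k) (B : set V).
Hypotheses (B0 : B 0) (BD : forall x y, B x -> B y -> B (x + y))
  (BZ : forall a x, B x -> B (a *: x)).
Implicit Types x y z : V.

Lemma modN x : B x -> B (- x).
Proof. by rewrite -scaleN1r; exact: BZ. Qed.

Lemma modB x y : B x -> B y -> B (x - y).
Proof. by move=> Bx By; apply: BD => //; exact: modN. Qed.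

Lemma mod_sum (I : Type) (r : seq I) (F : I -> V) :
  (forall i, B (F i)) -> B (\sum_(i <- r) F i).
Proof. by move=> BF; elim/big_ind: _. Qed.

Definition spans_mod r (f : 'I_r -> V) z :=
  exists c : 'rV[k]_r, B (z - \sum_i c 0 i *: f i).

(** The condition of [H1_basis] on boundaries, for an arbitrary subspace [B].
    *)
Definition basis_mod n (e : 'I_n -> V) :=
  forall z, exists! c : 'rV[k]_n, B (z - \sum_i c 0 i *: e i).

Lemma spans_modP r (f : 'I_r -> V) z (c : 'I_r -> k) :
  B (z - \sum_i c i *: f i) -> spans_mod f z.
Proof.
move=> Bz; exists (\row_i c i).
by rewrite (eq_bigr (fun i => c i *: f i)) // => i _; rewrite mxE.
Qed.

Lemma spans_mod0 r (f : 'I_r -> V) z : B z -> spans_mod f z.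
Proof.
move=> Bz; apply: (spans_modP (c := fun=> 0)).
by rewrite big1 ?subr0 // => i _; rewrite scale0r.
Qed.

Lemma spans_mod_in r (f : 'I_r -> V) i : spans_mod f (f i).
Proof.
apply: (spans_modP (c := fun j => (j == i)%:R)).
rewrite (bigD1 i) //= eqxx scale1r big1 ?addr0 ?subrr //.
by move=> j /negbTE ->; rewrite scale0r.
Qed.

Lemma spans_modD r (f : 'I_r -> V) y z :
  spans_mod f y -> spans_mod f z -> spans_mod f (y + z).
Proof.
move=> [c Bc] [c' Bc']; exists (c + c').
rewrite (eq_bigr (fun i => c 0 i *: f i + c' 0 i *: f i)); last first.
  by move=> i _; rewrite mxE scalerDl.
by rewrite big_split /= opprD addrACA; exact: BD.
Qed.

Lemma spans_modZ r (f : 'I_r -> V) a z : spans_mod f z -> spans_mod f (a *: z).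
Proof.
move=> [c Bc]; exists (a *: c).
rewrite (eq_bigr (fun i => a *: (c 0 i *: f i))); last by move=> i _; rewrite mxE scalerA.
by rewrite -scaler_sumr -scalerBr; exact: BZ.
Qed.

(** Expressing each family in the other gives matrices with [P *m Q = 1], by
    uniqueness of coordinates. *)
Lemma basis_mod_leq n (e : 'I_n -> V) r (f : 'I_r -> V) :
  basis_mod e -> (forall z, spans_mod f z) -> (n <= r)%N.
Proof.
move=> eP fP.
have [P PP] := @boolp.choice _ _ (fun i (c : 'rV[k]_r) => B (e i - \sum_j c 0 j *: f j))
  (fun i => fP (e i)).
have [Q QP] := @boolp.choice _ _ (fun j (c : 'rV[k]_n) => B (f j - \sum_l c 0 l *: e l))
  (fun j => let: ex_intro c h := eP (f j) in ex_intro _ c h.1).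
apply: (@mulmx1_min _ n r (\matrix_i P i) (\matrix_j Q j)).
apply/row_matrixP => i; rewrite row_mul rowK row1.
have [c [_ cU]] := eP (e i).
rewrite -(cU (delta_mx 0 i)); last first.
  rewrite (bigD1 i) //= mxE !eqxx scale1r big1 ?addr0 ?subrr //.
  by move=> j /negbTE ne; rewrite mxE ne andbF scale0r.
apply/esym/cU => /=.
suff Bi : B (\sum_j P i 0 j *: f j - \sum_l (P i *m \matrix_j Q j) 0 l *: e l).
  by have := BD (PP i) Bi; rewrite addrA subrK.
have -> : \sum_l (P i *m \matrix_j Q j) 0 l *: e l =
    \sum_j P i 0 j *: (\sum_l Q j 0 l *: e l).
  under eq_bigr do rewrite mxE scaler_suml.
  rewrite exchange_big /=; apply: eq_bigr => j _.
  by rewrite scaler_sumr; apply: eq_bigr => l _; rewrite mxE scalerA.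
rewrite -sumrB; apply: mod_sum => j.
by rewrite -scalerBr; exact: BZ.
Qed.

(** A spanning family of minimal size is a basis: a nontrivial relation allows
    one to drop a member. *)
Lemma basis_mod_exists r (f : 'I_r -> V) : (forall z, spans_mod f z) ->
  exists2 n, (n <= r)%N & exists e : 'I_n -> V, basis_mod e.
Proof.
move=> fP; pose S n := `[< exists e : 'I_n -> V, forall z, spans_mod e z >].
have exS : exists n, S n by exists r; apply/asboolP; exists f.
case: (ex_minnP exS) => n /asboolP[e eP] n_min; exists n.
  by apply: n_min; apply/asboolP; exists f.
exists e => z.
have [c cP] := eP z; exists c; split=> // c' c'P; apply: contrapT => ne.
have [b b_ne Bb] : exists2 b : 'rV[k]_n, b != 0 & B (\sum_i b 0 i *: e i).
  exists (c' - c); first by rewrite subr_eq0; apply/eqP => E; apply: ne.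
  have := modB cP c'P; rewrite opprB addrC addrA subrK.
  rewrite -sumrB (eq_bigr (fun i => (c' - c) 0 i *: e i)) //.
  by move=> i _; rewrite !mxE scalerBl.
have [i0 bi0] : exists i, b 0 i != 0 by apply/rV0Pn.
case: n => [|n] in e eP n_min c cP c' c'P ne b b_ne Bb i0 bi0 *; first by case: i0 bi0.
suff : S n by move=> /n_min; rewrite ltnn.
apply/asboolP; exists (e \o lift i0) => y; have [a aP] := eP y.
apply: (spans_modP (c := fun j => a 0 (lift i0 j) - a 0 i0 / b 0 i0 * b 0 (lift i0 j))).
have := BD aP (BZ (a 0 i0 / b 0 i0) Bb).
have -> : y - \sum_i a 0 i *: e i + (a 0 i0 / b 0 i0) *: \sum_i b 0 i *: e i =
    y - \sum_i (a 0 i - a 0 i0 / b 0 i0 * b 0 i) *: e i.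
  rewrite -addrA scaler_sumr; congr (y + _); rewrite addrC -opprB -sumrB; congr (- _).
  by apply: eq_bigr => i _; rewrite scalerBl scalerA.
by rewrite (bigD1_ord i0) //= divfK // subrr scale0r add0r.
Qed.

Section Classes.
Variables (H : groupType) (cls : H -> V).
Hypothesis clsM : forall g h, B (cls (g * h)%g - (cls g + cls h)).

Lemma cls1 : B (cls 1%g).
Proof. by have := modN (clsM 1%g 1%g); rewrite mulg1 opprB addrK. Qed.

Lemma clsX g n : B (cls (g ^+ n)%g - n%:R *: cls g).
Proof.
elim: n => [|n IH]; first by rewrite expg0 scale0r subr0; exact: cls1.
have := BD (clsM g (g ^+ n)%g) IH.
rewrite -expgS opprD [X in B (X + _)]addrA subrKA -addrA -opprD.
by rewrite mulrS scalerDl scale1r.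
Qed.

Lemma cls_torsion g n : (n%:R : k) != 0 -> (g ^+ n)%g = 1%g -> B (cls g).
Proof.
move=> n0 gn; have /modN := modB (clsX g n) cls1.
rewrite gn addrAC subrr sub0r opprK => /(BZ n%:R^-1).
by rewrite scalerA mulVf // scale1r.
Qed.

(** A class of an element of finite order invertible in [k] is zero, because
    the class map is additive. *)
Lemma spans_mod_cls (hs : seq H) :
  gen ([set` hs] `|` [set h | exists2 n, (n%:R : k) != 0 & (h ^+ n)%g = 1%g]) = setT ->
  forall h, spans_mod (fun i : 'I_(size hs) => cls (nth 1%g hs i)) (cls h).
Proof.
move=> genH h; have : [set: H] h by [].
rewrite -genH; elim=> [|{}h [/= hhs|[n n0 hn]]|g {}h _ IHg _ IHh|g _ IHg].
- exact/spans_mod0/cls1.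
- have lt_h : (index h hs < size hs)%N by rewrite index_mem.
  have := spans_mod_in (fun i : 'I_(size hs) => cls (nth 1%g hs i)) (Ordinal lt_h).
  by rewrite /= nth_index.
- exact/spans_mod0/(cls_torsion n0 hn).
- rewrite -[cls _](subrK (cls g + cls h)); apply: spans_modD; first exact/spans_mod0/clsM.
  exact: spans_modD.
- have E : cls g^-1%g = - (cls (g * g^-1)%g - (cls g + cls g^-1%g)) + (cls 1%g + (-1) *: cls g).
    by rewrite mulgV opprB scaleN1r addrA subrK addrAC subrr add0r.
  rewrite E; apply: spans_modD; first exact/spans_mod0/modN/clsM.
  by apply: spans_modD; [exact/spans_mod0/cls1|exact: spans_modZ].
Qed.

End Classes.
End SpanModulo.

(** * First homology of the bar complex *)

Section BarComplex.
Variables (H : groupType) (k : fieldType).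
Local Notation C1 := (bar_chain H k 1).
Local Notation C2 := (bar_chain H k 2).
Implicit Types (x y z : C1) (g h : H).

Definition bar1 h : C1 := bar_basis k [ffun=> h].
Definition bar2 g h : C2 := bar_basis k [ffun i : 'I_2 => if i == ord0 then g else h].

Definition boundary z := exists y : C2, z = bar_diff y.

Lemma bar_diffE n : @bar_diff H k n =
  @lin_ext k _ _ (fun s => \sum_(i < n.+2) (-1) ^+ i *: bar_basis k (bar_face i s)).
Proof. by []. Qed.

Fact bar_diff_linear n : linear (@bar_diff H k n).
Proof. by rewrite bar_diffE; exact: lin_ext_linear. Qed.
HB.instance Definition _ n := GRing.isLinear.Build k (bar_chain H k n.+1) (bar_chain H k n) _
  (@bar_diff H k n) (@bar_diff_linear n).

Lemma boundary0 : boundary 0.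
Proof. by exists 0; rewrite linear0. Qed.

Lemma boundaryD x y : boundary x -> boundary y -> boundary (x + y).
Proof. by move=> [u ->] [v ->]; exists (u + v); rewrite linearD. Qed.

Lemma boundaryZ (a : k) x : boundary x -> boundary (a *: x).
Proof. by move=> [u ->]; exists (a *: u); rewrite linearZ. Qed.

(** With trivial coefficients all chains of degree one are cycles. *)
Lemma bar_diff1 z : bar_diff z = 0.
Proof.
rewrite bar_diffE /lin_ext big1 // => s _.
rewrite big_ord_recl big_ord1 /= expr0 expr1 scale1r scaleN1r.
rewrite (_ : bar_face (lift ord0 ord0) s = bar_face ord0 s) ?subrr ?scaler0 //.
by apply/ffunP => -[].
Qed.

Lemma bar_diff2 g h : bar_diff (bar2 g h) = bar1 h - bar1 (g * h)%g + bar1 g.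
Proof.
rewrite bar_diffE lin_extU alternating_sum3 /bar1.
set s : {ffun 'I_2 -> H} := [ffun i => if _ then _ else _].
have -> : bar_face ord0 s = [ffun=> h] by apply/ffunP => i; rewrite (ord1 i) !ffunE.
have -> : bar_face (lift ord0 ord0) s = [ffun=> (g * h)%g].
  by apply/ffunP => i; rewrite (ord1 i) !ffunE.
by have -> : bar_face ord_max s = [ffun=> g] by apply/ffunP => i; rewrite (ord1 i) !ffunE.
Qed.

(** The boundary of [[g|h]] is [[h] - [gh] + [g]]. *)
Lemma boundaryM g h : boundary (bar1 (g * h)%g - (bar1 g + bar1 h)).
Proof.
exists (- bar2 g h); rewrite linearN /= bar_diff2 [RHS]opprD opprB.
by rewrite -addrA -opprD [bar1 h + _]addrC.
Qed.

Lemma H1_basisE n (e : 'I_n -> C1) : H1_basis e <-> basis_mod boundary e.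
Proof.
split=> [[_ eP] z|eP]; first by apply: eP; exact: bar_diff1.
by split=> *; [exact: bar_diff1|exact: eP].
Qed.

Lemma chain_ind (P : C1 -> Prop) : P 0 -> (forall x y, P x -> P y -> P (x + y)) ->
  (forall a x, P x -> P (a *: x)) -> (forall h, P (bar1 h)) -> forall x, P x.
Proof.
move=> P0 PD PZ P1; apply: malg_ind => // s.
have := P1 (s ord0); rewrite /bar1 (_ : [ffun=> _] = s) //.
by apply/ffunP => i; rewrite ffunE (ord1 i).
Qed.

Lemma b1_upper (R : realType) (hs : seq H) :
  gen ([set` hs] `|` [set h | exists2 n, (n%:R : k) != 0 & (h ^+ n)%g = 1%g]) = setT ->
  exists2 n, (n <= size hs)%N & b1 H k R = n%:R%:E.
Proof.
move=> genH; have cP := spans_mod_cls boundary0 boundaryD boundaryZ boundaryM genH.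
have fP z : spans_mod boundary (fun i : 'I_(size hs) => bar1 (nth 1%g hs i)) z.
  apply: (chain_ind _ _ _ cP) => [|x y|a x].
  - exact/spans_mod0/boundary0.
  - exact: (spans_modD boundaryD).
  - exact: (spans_modZ boundaryZ).
have [n le_n [e /H1_basisE eB]] := basis_mod_exists boundaryD boundaryZ fP.
rewrite /b1; case: xgetP => [u -> [m [e' e'B] <-]|/(_ n%:R%:E) []]; last first.
  by exists n => //; exists e.
exists m => //; move: e'B => /H1_basisE e'B.
exact: (basis_mod_leq boundary0 boundaryD boundaryZ e'B fP).
Qed.

Lemma b1_lower (R : realType) (b : \bar R) :
  (forall n (e : 'I_n -> C1), H1_basis e -> (b <= n%:R%:E)%E) -> (b <= b1 H k R)%E.
Proof.
move=> bP; rewrite /b1; case: xgetP => [u -> [m [e' e'B] <-]|_]; first exact: bP e'B.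
by rewrite leey.
Qed.

(** A homomorphism to [k] extends linearly to chains and kills boundaries, so
    it factors through the first homology. *)
Lemma hom_basis_vanish n (e : 'I_n -> C1) (phi : H -> k) :
  H1_basis e -> {morph phi : g h / (g * h)%g >-> g + h} ->
  (forall i, \sum_(s <- monalg.msupp (e i)) monalg.mcoeff s (e i) * phi (s ord0) = 0) ->
  forall h, phi h = 0.
Proof.
move=> [_ eP] phiM phie h.
pose L : C1 -> k^o := lin_ext (fun s : {ffun 'I_1 -> H} => phi (s ord0) : k^o).
have Lh g : L (bar1 g) = phi g by rewrite /L lin_extU ffunE.
have L0 : L 0 = 0 by rewrite /L linear0.
have LD x y : L (x + y) = L x + L y by rewrite /L linearD.
have LZ a x : L (a *: x) = a * L x by rewrite /L linearZ.
have LN x : L (- x) = - L x by rewrite -scaleN1r LZ mulN1r.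
have LB z : boundary z -> L z = 0.
  move=> [y ->] {z}; elim/malg_ind: y => [|x y Lx Ly|a x Lx|s].
  - by rewrite linear0.
  - by rewrite linearD LD Lx Ly addr0.
  - by rewrite linearZ LZ Lx mulr0.
  - have -> : monalg.mkmalgU s 1 = bar2 (s ord0) (s ord_max).
      congr monalg.mkmalgU; apply/ffunP => -[[|[|//]] lt_i]; rewrite ffunE /=;
        by congr (s _); exact: val_inj.
    by rewrite bar_diff2 !LD LN !Lh phiM opprD addrCA subrr addr0 addNr.
have [c [cP _]] := eP (bar1 h) (bar_diff1 _).
have Lsum : L (\sum_i c 0 i *: e i) = 0.
  elim/big_ind: _ => // [x y Lx Ly|i _]; first by rewrite LD Lx Ly addr0.
  by rewrite LZ [L _](phie i) mulr0.
by have := LB _ cP; rewrite LD LN Lsum subr0 Lh.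
Qed.

End BarComplex.

(** * Subgroups of a quotient group *)

Section ClosedPredicate.
Variables (G : groupType) (H : set G) (sH : is_subgroup H).

Definition subgroup_pred (_ : is_subgroup H) : {pred G} := fun x => `[< H x >].

Fact subgroup_predM : mulg_closed (subgroup_pred sH).
Proof. by move=> x y /asboolP Hx /asboolP Hy; apply/asboolP; exact: subgroupM. Qed.
Fact subgroup_pred1 : 1%g \in subgroup_pred sH.
Proof. by apply/asboolP; exact: subgroup1. Qed.
Fact subgroup_predV : invg_closed (subgroup_pred sH).
Proof. by move=> x /asboolP Hx; apply/asboolP; exact: subgroupV. Qed.

HB.instance Definition _ := isMulClosed.Build G (subgroup_pred sH) subgroup_predM.
HB.instance Definition _ := isMul1Closed.Build G (subgroup_pred sH) subgroup_pred1.
HB.instance Definition _ := isInvClosed.Build G (subgroup_pred sH) subgroup_predV.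

Definition groupClosed_of : groupClosed G := subgroup_pred sH.

Lemma groupClosed_ofP x : reflect (H x) (x \in groupClosed_of).
Proof. exact: asboolP. Qed.

End ClosedPredicate.

Lemma groupClosed_subgroup (G : groupType) (Hc : groupClosed G) :
  is_subgroup [set x | x \in Hc].
Proof.
by split=> /= [|x y|x]; [exact: gpred1|exact: gpredM|exact: gpredVr].
Qed.

Lemma transversal_index (G : groupType) (Hc : groupClosed G) n t c :
  @is_transversal G [set x | x \in Hc] n t c -> subgroup_index Hc = n.
Proof.
move=> tc; have sH := groupClosed_subgroup Hc.
pose co (x : G) : set G := [set (x * h)%g | h in [set` Hc]].
have coE x y : co x y <-> (x^-1 * y)%g \in Hc.
  split=> [[h /= Hh <-]|Hxy]; first by rewrite mulKg.
  by exists (x^-1 * y)%g => //; rewrite mulVKg.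
have co_inj : injective (co \o t).
  move=> i j /= E; rewrite -(transversalK tc i) -(transversalK tc j).
  by apply: (transversal_eq tc); apply/coE; rewrite E; apply/coE; rewrite mulVg gpred1.
have -> : subgroup_index Hc = #|` [fset (co \o t) i | i in 'I_n]%fset|.
  rewrite /subgroup_index; congr #|` _|; rewrite -[RHS]set_fsetK; congr fset_set.
  apply/seteqP; split=> [_ [x _ <-]|B /= /imfsetP[i _ ->]]; last by exists (t i).
  apply/imfsetP; exists (c x) => //=; apply/seteqP; split=> z.
    move/coE => Hz; apply/coE.
    have := subgroupM sH (transversal_rep tc x) Hz.
    by rewrite /= -mulgA mulVKg.
  move/coE => Hz; apply/coE.
  have := subgroupM sH (subgroupV sH (transversal_rep tc x)) Hz.
  by rewrite /= invgM invgK -mulgA mulVKg.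
by rewrite card_imfset //= size_enum_ord.
Qed.

Section ImageSubgroup.
Variables (X G : groupType) (N : set X) (f : X -> G) (fQ : is_quotient N f).
Variables (K : set X) (NK : N `<=` K).

Definition image_set : set G := [set f x | x in K].

Lemma image_setP x : is_subgroup K -> image_set (f x) <-> K x.
Proof.
move=> sK; split=> [[y Ky /(quotient_eq fQ) /NK]|Kx]; last by exists x.
exact: (subgroupMl sK (subgroupV sK Ky)).
Qed.

Lemma image_subgroup : is_subgroup K -> is_subgroup image_set.
Proof.
move=> sK; split.
- by exists 1%g; [exact: subgroup1|exact: (quotient1 fQ)].
- move=> _ _ [x Kx <-] [y Ky <-]; exists (x * y)%g; last exact: (quotientM fQ).
  exact: subgroupM.
- by move=> _ [x Kx <-]; exists (x^-1)%g; [exact: subgroupV|exact: (quotientV fQ)].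
Qed.

Lemma image_transversal n t c : is_subgroup K -> @is_transversal X K n t c ->
  exists t' c', @is_transversal G image_set n t' c'.
Proof.
move=> sK tc; have [g gK] := boolp.choice (quotient_surj fQ).
have cf x y : f x = f y -> c x = c y.
  by move=> /(quotient_eq fQ) /NK; exact: (transversal_eq tc).
exists (f \o t), (c \o g); split=> /= [x|x y|i].
- rewrite -{2}(gK x) -(quotientV fQ) -(quotientM fQ); apply/image_setP => //.
  exact: (transversal_rep tc).
- rewrite -{1}(gK x) -{1}(gK y) -(quotientV fQ) -(quotientM fQ).
  by move=> /image_setP Kxy; apply: (transversal_eq tc); exact: Kxy.
- by rewrite -[RHS](transversalK tc); apply: cf; rewrite gK.
Qed.

End ImageSubgroup.

(** * Homology of a subgroup of a quotient group *)

Section ImageHomology.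
Variables (X G : groupType) (N : set X) (f : X -> G) (fQ : is_quotient N f).
Variables (K : set X) (sK : is_subgroup K) (NK : N `<=` K).

Definition image_closed : groupClosed G := groupClosed_of (image_subgroup fQ sK).
Local Notation H := (subgroup_type image_closed).

Lemma image_closedP x : f x \in image_closed <-> K x.
Proof.
split=> [/groupClosed_ofP|Kx]; first by move/(image_setP fQ NK x sK).
by apply/groupClosed_ofP; exists x.
Qed.

Lemma image_closed_index n t c : @is_transversal X K n t c -> subgroup_index image_closed = n.
Proof.
move=> tc; have [t' [c' t'c']] := image_transversal fQ NK sK tc.
apply: (@transversal_index _ _ n t' c').
suff -> : [set x | x \in image_closed] = image_set f K by [].
by apply/seteqP; split=> x /= ?; apply/(groupClosed_ofP (image_subgroup fQ sK)).
Qed.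

Lemma image_closed_lift (u : H) : exists x, K x /\ f x = Defs.sgval u.
Proof. by have [x Kx <-] := groupClosed_ofP _ _ (Defs.sgvalP u); exists x. Qed.

(** The projection of [X] to the image of [K]; it is meaningful on [K] only,
    and takes the value [1] elsewhere. *)
Definition restr (x : X) : H := insubd (1%g : H) (f x).

Lemma restrE x : K x -> Defs.sgval (restr x) = f x.
Proof. by move=> Kx; rewrite -[LHS]/(val _) val_insubd (image_closedP x).2. Qed.

Lemma restr_lift (u : H) : exists2 x, K x & restr x = u.
Proof.
have [x [Kx fx]] := image_closed_lift u; exists x => //.
by apply: val_inj; rewrite /= restrE.
Qed.

Lemma restrM x y : K x -> K y -> restr (x * y)%g = (restr x * restr y)%g.
Proof.
move=> Kx Ky; apply: val_inj; rewrite valM /= !restrE ?(quotientM fQ) //.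
exact: subgroupM.
Qed.

Lemma restr1 x : N x -> restr x = 1%g.
Proof.
move=> Nx; apply: val_inj; rewrite val1 /= restrE; last exact: NK.
exact/(quotient_ker fQ).
Qed.

Lemma restr_eq x y : K x -> K y -> restr x = restr y <-> N (x^-1 * y)%g.
Proof.
move=> Kx Ky; rewrite -(quotient_eq fQ) -(restrE Kx) -(restrE Ky).
by split=> [->//|E]; apply: val_inj.
Qed.

Lemma restrX x n : K x -> restr (x ^+ n)%g = (restr x ^+ n)%g.
Proof.
move=> Kx; elim: n => [|n IH].
  by rewrite !expg0 restr1 //; apply/(quotient_ker fQ); exact: (quotient1 fQ).
by rewrite !expgS restrM ?IH //; exact: subgroupX.
Qed.

Lemma restrV x : K x -> restr x^-1%g = (restr x)^-1%g.
Proof.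
move=> Kx; apply/esym; apply: mulg1_eq; rewrite -restrM ?mulgV //; last exact: subgroupV.
by apply: restr1; apply/(quotient_ker fQ); exact: (quotient1 fQ).
Qed.

Lemma image_b1_upper (R : realType) (k : fieldType) (ys cs : seq X) (M : set X) :
  M `<=` N -> [set` ys] `<=` K -> [set` cs] `<=` K ->
  K `<=` gen (M `|` [set` ys] `|` [set` cs]) ->
  {in cs, forall c, exists2 m, (m%:R : k) != 0 & N (c ^+ m)%g} ->
  exists2 n, (n <= size ys)%N & b1 H k R = n%:R%:E.
Proof.
move=> MN ysK csK Kgen tor; rewrite -(size_map restr); apply: b1_upper.
apply/seteqP; split=> // u _; have [x Kx <-] := restr_lift u.
set S := (X in gen X).
suff [] : [set x | K x /\ gen S (restr x)] x by [].
apply: gen_min (Kgen _ Kx) => [|z [[Mz|zys]|zcs]].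
- have N1 : N 1%g by apply/(quotient_ker fQ); exact: (quotient1 fQ).
  split; first by split; [exact: subgroup1|rewrite restr1 //; exact: gen_one].
    move=> y z [Ky gy] [Kz gz]; split; first exact: subgroupM.
    by rewrite restrM //; exact: gen_mul.
  by move=> y [Ky gy]; split; [exact: subgroupV|rewrite restrV //; exact: gen_inv].
- by split; [exact/NK/MN|rewrite restr1; [exact: gen_one|exact: MN]].
- split; first exact: ysK.
  by apply: gen_in; left; apply/mapP; exists z.
- split; first exact: csK.
  apply: gen_in; right; have [m m0 Nm] := tor _ zcs.
  by exists m => //; rewrite -restrX ?restr1 //; exact: csK.
Qed.

(** A basis of the first homology gives functionals on homomorphisms by
    evaluation of chains, once the group elements are lifted to [K]. *)
Lemma image_b1_lower (R : realType) (b : \bar R) :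
  (forall nb (fam : 'I_nb -> seq (rat * X)),
     (forall phi : X -> rat, hom_on K phi -> (forall x, N x -> phi x = 0) ->
        (forall i, \sum_(s <- fam i) s.1 * phi s.2 = 0) -> forall x, K x -> phi x = 0) ->
     (b <= nb%:R%:E)%E) ->
  (b <= b1 H rat R)%E.
Proof.
move=> bP; apply: b1_lower => n e eB.
have [lift liftP] := boolp.choice (fun u => let: ex_intro2 x Kx E := restr_lift u in
  ex_intro (fun x => K x /\ restr x = u) x (conj Kx E)).
apply: (bP n (fun i => [seq (monalg.mcoeff s (e i), lift (s ord0)) | s <- monalg.msupp (e i)])).
move=> phi homphi phiN phi0 x Kx.
have K1 : K 1%g by exact: subgroup1.
have phi_eq y z : K y -> K z -> restr y = restr z -> phi y = phi z.
  move=> Ky Kz /(restr_eq Ky Kz) /phiN; rewrite homphi //; last exact: subgroupV.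
  by rewrite (hom_onV sK) // addrC => /eqP; rewrite subr_eq0 => /eqP.
rewrite (phi_eq x (lift (restr x))) ?(liftP _).2 //; last exact: (liftP _).1.
apply: (@hom_basis_vanish _ _ n e (phi \o lift) eB) => [u v|i] /=.
  have [[Ku Eu] [Kv Ev]] := (liftP u, liftP v).
  rewrite -homphi //; apply: phi_eq; first exact: (liftP _).1.
    exact: subgroupM.
  by rewrite restrM // Eu Ev (liftP _).2.
by have := phi0 i; rewrite big_map.
Qed.

End ImageHomology.

(** * The theorem *)

Lemma limn_einf_ge (R : realType) (u : (\bar R)^nat) (b : \bar R) :
  (forall n, (b <= u n)%E) -> (b <= limn_einf u)%E.
Proof.
move=> bu; rewrite limn_einf_lim; apply: lime_ge; first exact: is_cvg_einfs.
by near=> n; apply: le_ereal_inf_tmp => _ [m _ <-]; exact: bu.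
Unshelve. all: by end_near. Qed.

(** Stage [i] uses the growth factor [i.+2], so that the ratio at [(2 * i).+1
    = 2 * i.+1 - 1] is at most the value of the harmonic sequence at [i.+1].
    *)
Lemma alternating_chain_exists (R : realType) (d p : nat) (eps : rat) :
  (2 <= d)%N -> prime p -> 0 < eps < 1 ->
  exists (G : groupType) (Gs : nat -> groupClosed G),
    [/\ generated_by_elements G d, p_power_chain p Gs,
        forall i, ((d%:R - 1 - ratr eps)%:E <= b1_ratio R rat (Gs (2 * i)%N))%E &
        forall k : fieldType, (p%:R : k) != 0 -> forall i,
          (0 <= b1_ratio R k (Gs (2 * i).+1) <= (i.+2%:R^-1)%:E)%E].
Proof.
move=> d_gt1 p_pr /andP[eps0 eps1].
have A_gt1 : (1 < #|'I_d|)%N by rewrite card_ord.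
have [K [L [rels tw]]] := tower_exists p_pr A_gt1 eps0 eps1.
have nN := tower_cap_normal tw.
have [G [f fQ]] := quotient_exists nN.
pose E := tower_chain K L.
have pE n : p_normal p (E n) := tower_chain_normal tw n.
have sE n : is_subgroup (E n) := pE n.
have EK i : E (2 * i)%N = K i by exact: tower_chain_even.
have EL i : E (2 * i).+1 = L i by exact: tower_chain_odd.
have E0 : E 0%N = setT by rewrite /E /tower_chain /= (tower0 tw).
have NE n : tower_cap K `<=` E n.
  case: n => [|n] x Nx; first by rewrite E0.
  by apply: (tower_cap_chain tw x).1.
pose Gs n := image_closed fQ (sE n).
have GsP n x : f x \in Gs n <-> E n x by exact: image_closedP.
exists G, Gs; split.
- exists (fun i => f (free_gen i)) => H Hgen u; rewrite [RHS]inE.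
  have [x <-] := quotient_surj fQ u.
  have : gen (range (@free_gen 'I_d)) x by rewrite gen_free_gen.
  elim=> [|_ [i _ <-]|y z _ Hy _ Hz|y _ Hy].
  + by rewrite (quotient1 fQ) gpred1.
  + exact: Hgen.
  + by rewrite (quotientM fQ) gpredM.
  + by rewrite (quotientV fQ) gpredVr.
- split.
  + move=> u; have [x <-] := quotient_surj fQ u; rewrite [RHS]inE.
    by apply/GsP; rewrite E0.
  + move=> n u; have [x <-] := quotient_surj fQ u => /GsP Ex; apply/GsP.
    exact: tower_chain_sub tw n x Ex.
  + move=> n u v; have [x <-] := quotient_surj fQ u; have [y <-] := quotient_surj fQ v.
    by move=> /GsP Ex; rewrite -(quotientJ fQ); apply/GsP; exact: (normal_conj (pE n)).
  + move=> n; have [m [t [c tc]]] := finite_index_transversal (sE n) (p_normal_finite (pE n)).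
    have [e me] := transversal_pow p_pr (pE n) tc.
    by exists e; rewrite (image_closed_index fQ (sE n) (NE n) tc).
  + apply/seteqP; split=> u.
      have [x <-] := quotient_surj fQ u => Hx; apply/(quotient_ker fQ).
      by apply/(tower_cap_chain tw) => n n_gt0; apply/GsP; exact: Hx.
    by move=> -> n _ /=; exact: gpred1.
- move=> i; rewrite /b1_ratio.
  have [n [t [c tc]]] := finite_index_transversal (sE (2 * i)%N) (p_normal_finite (pE (2 * i)%N)).
  rewrite (image_closed_index fQ (sE _) (NE _) tc).
  have n_gt0 : (0 < n)%N by have := c 1%g => -[m]; exact: leq_ltn_trans.
  rewrite lee_pdivlMr ?ltr0n //.
  apply: (image_b1_lower fQ (sE _) (NE _)) => nb fam famP.
  rewrite -EFinM lee_fin.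
  have [_ ordK sumK] := tower_admissible tw i.
  have pKi := pE (2 * i)%N; rewrite EK in pKi tc famP.
  have : n%:R * (#|'I_d|%:R - 1 - \sum_(r <- rels i) r.2%:R^-1) <= nb%:R :> rat.
    apply: (hom_count pKi tc ordK (fam := fam)) => phi homphi phi0 [D D0 Dint] phifam.
    apply: famP => // x Nx.
    exact: (tower_hom_cap p_pr tw homphi phi0 D0 Dint).
  rewrite card_ord => le_nb.
  have : n%:R * (d%:R - 1 - eps) <= nb%:R :> rat.
    apply: le_trans le_nb; rewrite ler_pM2l ?ltr0n //.
    by move: sumK; lra.
  by rewrite -(ler_rat R) rmorphM !rmorphB /= !ratr_nat rmorph1 mulrC.
- move=> k p0 i.
  have [n [t [c tc]]] := finite_index_transversal (sE (2 * i).+1) (p_normal_finite (pE (2 * i).+1)).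
  rewrite /b1_ratio (image_closed_index fQ (sE _) (NE _) tc).
  have n_gt0 : (0 < n)%N by have := c 1%g => -[m]; exact: leq_ltn_trans.
  have [ys [cs [ysL csL Lgen tor growth]]] := next_growth (tower_next tw i).
  have tcL := tc; rewrite EL in tcL.
  have [m le_m ->] : exists2 m, (m <= size ys)%N &
      b1 (subgroup_type (Gs (2 * i).+1)) k R = m%:R%:E.
    apply: (@image_b1_upper _ _ _ _ fQ _ (sE _) (NE _) R k ys cs (relator_closure (rels i))).
    + by move=> x Mx j; exact: tower_relators tw i j x Mx.
    + by rewrite EL.
    + by rewrite EL.
    + by rewrite EL.
    + move=> x /tor [e eP]; exists (p ^ e)%N; first by rewrite natrX expf_neq0.
      exact: (tower_cap_torsion tw eP).
  rewrite -EFinM !lee_fin divr_ge0 //= ler_pdivrMr ?ltr0n // mulrC ler_pdivlMr ?ltr0n //.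
  rewrite -natrM ler_nat; apply: leq_trans (growth _ _ _ tcL).
  by rewrite leq_mul2r le_m orbT.
Qed.

Lemma natr_Fp_neq0 (p q : nat) : prime p -> prime q -> q <> p -> (p%:R : 'F_q) != 0.
Proof.
move=> p_pr q_pr ne; rewrite -(dvdn_pcharf (pchar_Fp q_pr)) dvdn_prime2 //.
exact/eqP.
Qed.

Theorem theorem5p1 (R : realType) (d p : nat) (eps : R)
  (hd : (2 <= d)%N) (hp : prime p) (heps : 0 < eps < 1) :
  (exists (G : groupType) (Gs : nat -> groupClosed G),
    [/\ generated_by_elements G d, p_power_chain p Gs,
        ((d%:R - 1 - eps)%:E <=
           limn_einf (fun i : nat => b1_ratio R rat (Gs (2 * i)%N)))%E &
        (fun i : nat => b1_ratio R rat (Gs (2 * i - 1)%N)) @ \oo --> 0%E])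
  /\
  (forall q : nat, prime q -> q <> p ->
    exists (G : groupType) (Gs : nat -> groupClosed G),
    [/\ generated_by_elements G d, p_power_chain p Gs,
        ((d%:R - 1 - eps)%:E <=
           limn_einf (fun i : nat => b1_ratio R rat (Gs (2 * i)%N)))%E &
        (fun i : nat => b1_ratio R 'F_q (Gs (2 * i - 1)%N)) @ \oo --> 0%E]).
Proof.
have /andP[eps0 eps1] := heps.
(* the dimension count is over the rationals, so a rational eps is needed *)
have [e0] := rat_in_itvoo eps0; rewrite in_itv /= => /andP[e0_gt0 e0_lt].
have e0_01 : 0 < e0 < 1.
  apply/andP; split; first by rewrite -(ltr_rat R) raddf0.
  by rewrite -(ltr_rat R) rmorph1 (lt_trans e0_lt).
have [G [Gs [genG chainG even odd]]] := alternating_chain_exists R hd hp e0_01.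
have liminf : ((d%:R - 1 - eps)%:E <=
    limn_einf (fun i : nat => b1_ratio R rat (Gs (2 * i)%N)))%E.
  apply: limn_einf_ge => n; apply: le_trans (even n); rewrite lee_fin.
  by rewrite lerD2l lerN2 ltW.
have lim0 (k : fieldType) : (p%:R : k) != 0 ->
    (fun i : nat => b1_ratio R k (Gs (2 * i - 1)%N)) @ \oo --> 0%E.
  move=> pk0.
  apply: (@squeeze_cvge _ _ _ _ (cst 0%E) _ (fun i => (harmonic i)%:E)).
  - near=> i; have : (0 < i)%N by near: i; exact: nbhs_infty_gt.
    move: (i) => [//|j] _; rewrite mulnS add2n subn1; exact: odd.
  - exact: cvg_cst.
  - by apply: cvg_EFin; [exact: nearW|exact: cvg_harmonic].
split; first by exists G, Gs; split=> //; apply: lim0; rewrite pnatr_eq0 -lt0n prime_gt0.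
move=> q q_pr ne; exists G, Gs; split=> //; apply: lim0.
exact: natr_Fp_neq0.
Unshelve. all: by end_near. Qed.
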